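(* Let $(\mathcal V,p,e)$ be a complete hyperbolic system of degree $n$. Then the following statements hold: (a) $\mathrm{DS}_n(\mathcal V)$ is nonempty, compact and convex in $\mathcal V^n$. (b) $\mathrm{JF}_n(\mathcal V)=\{\mathbf A\in\mathrm{DS}_n(\mathcal V):\ \exists\,\mathbf B\in\mathrm{DS}_n(\mathcal V),\ \mathbf A*\mathbf B=I_n\}$, where $I_n$ is the $n\times n$ identity matrix. (c) $\mathrm{JF}_n(\mathcal V)\subseteq\mathrm{GJF}_n(\mathcal V)\subseteq\operatorname{Ext}(\mathrm{DS}_n(\mathcal V))$.
   Context: A hyperbolic system $(\mathcal V,p,e)$ of degree $n$ consists of a nonzero finite-dimensional real vector space $\mathcal V$, a nonzero element $e\in\mathcal V$, and a real homogeneous polynomial $p$ of degree $n$ on $\mathcal V$ such that $p(e)\neq 0$ and, for each $x\in\mathcal V$, the univariate polynomial $t\mapsto p(te-x)$ has only real zeros. For $x\in\mathcal V$, $\lambda(x)=(\lambda_1(x),\dots,\lambda_n(x))^T\in\mathbb R^n$ is the vector of these zeros (with multiplicity) in decreasing order. The hyperbolicity cone is $\Lambda_+=\{x\in\mathcal V:\lambda(x)\ge 0\}$; write $x\le y$ when $y-x\in\Lambda_+$. The trace is $\operatorname{tr}(x)=\sum_{i=1}^n\lambda_i(x)$. The system is complete if $\lambda(x)=0$ implies $x=0$. In that case $\langle x,y\rangle=\frac14\big[\|\lambda(x+y)\|^2-\|\lambda(x-y)\|^2\big]$ is known to be an inner product on $\mathcal V$, and $\mathcal V^n$ (the Cartesian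 product of $n$ copies of $\mathcal V$) is the corresponding Hilbert space. A $\mathcal V$-matrix is an $n$-tuple $\mathbf A=[a_1,\dots,a_n]\in\mathcal V^n$. It is $e$-doubly stochastic if $a_i\in\Lambda_+$ and $\operatorname{tr}(a_i)=1$ for all $i$, and $a_1+\dots+a_n=e$. For $\mathcal V$-matrices $\mathbf A=[a_1,\dots,a_n]$, $\mathbf B=[b_1,\dots,b_n]$, $\mathbf A*\mathbf B$ is the $n\times n$ real matrix with $(i,j)$ entry $\langle a_i,b_j\rangle$. A set $\{c_1,\dots,c_n\}$ in $\mathcal V$ is a Jordan frame if $\lambda(c_i)=(1,0,\dots,0)^T$ for all $i$ and $c_1+\dots+c_n=e$; the $\mathcal V$-matrix $[c_1,\dots,c_n]$ is then a JF-matrix. $\operatorname{Ext}(S)$ is the set of extreme points of a convex set $S$. Let $\Delta=\{x\in\mathcal V: x\ge 0,\ \operatorname{tr}(x)=1\}$ and, for $b\in\mathcal V$, $\Delta(b)=\{x\in\Delta: 0\le x\le e-b\}$. A $\mathcal V$-matrix $[a_1,\dots,a_n]$ is a generalized Jordan frame matrix (GJF-matrix) if there is a permutation $\sigma$ of $\{1,\dots,n\}$ such that $a_{\sigma(1)}\in\operatorname{Ext}(\Delta)$ and, for every $1\le k\le n-1$, $a_{\sigma(k+1)}\in\operatorname{Ext}\big(\Delta(a_{\sigma(1)}+\dots+a_{\sigma(k)})\big)$. $\mathrm{DS}_n(\mathcal V)$, $\mathrm{JF}_n(\mathcal V)$, $\mathrm{GJF}_n(\mathcal V)$ denote the sets of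 all $e$-doubly stochastic $\mathcal V$-matrices, all JF-matrices, and all GJF-matrices, respectively. *)

(* Defs.v *)
From HB Require Import structures.
From mathcomp Require Import all_boot all_order all_algebra all_fingroup.
From mathcomp Require Import all_classical all_reals all_analysis.
From mathcomp Require Import complex.
From mathcomp Require polyrcf.
(* The notations of [mpoly] clash with those of the analysis library. *)
From mathcomp Require Import -(notations) mpoly.

Set Implicit Arguments.
Unset Strict Implicit.
Unset Printing Implicit Defensive.

Import Order.TTheory GRing.Theory Num.Theory.

Local Open Scope classical_set_scope.
Local Open Scope ring_scope.

Section Polynomials.
Context {R : realType} {V : vectType R}.

Definition coords (x : V) : 'I_(\dim (fullv : {vspace V})) -> R :=
  fun i => coord (vbasis fullv) i x.

(* A polynomial on V is a polynomial in the coordinates with respect to the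
   basis [vbasis fullv]; its degree and homogeneity do not depend on the basis,
   and as R is infinite it is determined by its values [peval]. *)
Definition polynomial_on : Type :=
  mpoly (\dim (fullv : {vspace V})) R.

Definition peval (p : polynomial_on) (x : V) : R := meval (coords x) p.

Definition homogeneous (n : nat) (p : polynomial_on) : Prop :=
  p \is ishomog1 n mdeg.

(* The univariate polynomial t |-> p (t e - x), as [horner_pencil] shows. *)
Definition pencil (p : polynomial_on) (e x : V) : {poly R} :=
  mmap (@polyC R) (fun i => coords e i *: 'X - (coords x i)%:P) p.

Lemma horner_pencil p e x t : (pencil p e x).[t] = peval p (t *: e - x).
Proof.
rewrite /pencil /peval /meval /mmap horner_sum.
apply: eq_bigr => m _; rewrite hornerM hornerC /mmap1 horner_prod /=.
congr (_ * _); apply: eq_bigr => i _.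
rewrite horner_exp !hornerE /coords linearB linearZ /=; congr (_ ^+ _).
by rewrite mulrC.
Qed.

End Polynomials.
Arguments polynomial_on {R} V.

Definition only_real_zeros (R : realType) (f : {poly R}) : Prop :=
  forall z : R[i], root (map_poly (real_complex R) f) z -> complex.Im z = 0.

(* The real zeros of f, repeated according to multiplicity, in decreasing
   order ([rootsR f] lists the distinct ones in increasing order). *)
Definition zeros (R : realType) (f : {poly R}) : seq R :=
  rev (flatten [seq nseq (mup r f) r | r <- polyrcf.rootsR f]).

Record hyperbolic_system (R : realType) (V : vectType R) (n : nat) :=
  HyperbolicSystem {
    hpoly : polynomial_on V;
    hunit : V;
    hunit_neq0 : hunit != 0;
    hpoly_homogeneous : homogeneous n hpoly;
    hpoly_unit_neq0 : peval hpoly hunit != 0;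
    hpoly_real : forall x : V, only_real_zeros (pencil hpoly hunit x)
  }.

Section HyperbolicSystem.
Context {R : realType} {V : vectType R} {n : nat}.
Variable S : hyperbolic_system V n.

Local Notation e := (hunit S).

Definition lambda (x : V) : 'cV[R]_n :=
  \col_(i < n) nth 0 (zeros (pencil (hpoly S) e x)) i.

Definition sqnorm (u : 'cV[R]_n) : R := \sum_(i < n) u i 0 ^+ 2.

Definition hcone : set V := [set x | forall i, 0 <= lambda x i 0].

Definition hle (x y : V) : Prop := hcone (y - x).

Definition trace (x : V) : R := \sum_(i < n) lambda x i 0.

Definition complete_system : Prop := forall x : V, lambda x = 0 -> x = 0.

Definition inner (x y : V) : R :=
  4^-1 * (sqnorm (lambda (x + y)) - sqnorm (lambda (x - y))).

Definition vmatrix : Type := {ffun 'I_n -> V}.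

HB.instance Definition _ := GRing.Lmodule.copy vmatrix {ffun 'I_n -> V}.

Definition vnorm (A : vmatrix) : R :=
  Num.sqrt (\sum_(i < n) inner (A i) (A i)).

Definition vopen (U : set vmatrix) : Prop :=
  forall A, U A -> exists2 r : R, 0 < r & forall B, vnorm (B - A) < r -> U B.

Lemma vopenT : vopen setT.
Proof. by move=> A _; exists 1. Qed.

Lemma vopenI : setI_closed vopen.
Proof.
move=> U W oU oW A [UA WA].
have [r r0 rU] := oU _ UA; have [s s0 sW] := oW _ WA.
exists (Num.min r s); first by rewrite lt_min r0.
by move=> B; rewrite lt_min => /andP[/rU ? /sW].
Qed.

Lemma vopen_bigcup (I : Type) (f : I -> set vmatrix) :
  (forall i, vopen (f i)) -> vopen (\bigcup_i f i).
Proof.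
move=> of_ A [i _ fA]; have [r r0 rf] := of_ i A fA.
by exists r => // B /rf ?; exists i.
Qed.

Definition DS : set vmatrix := [set A |
  [/\ forall i, hcone (A i), forall i, trace (A i) = 1
    & \sum_(i < n) A i = e]].

Definition star (A B : vmatrix) : 'M[R]_n := \matrix_(i, j) inner (A i) (B j).

Definition JF : set vmatrix := [set C |
  (forall i, lambda (C i) = \col_(j < n) (j == 0 :> nat)%:R)
  /\ \sum_(i < n) C i = e].

Definition Ext (E : lmodType R) (K : set E) : set E := [set x | K x /\
  forall (y z : E) (t : R), K y -> K z -> 0 < t -> t < 1 ->
    x = t *: y + (1 - t) *: z -> y = x /\ z = x].

Definition Delta : set V := [set x | hle 0 x /\ trace x = 1].

Definition Delta_below (b : V) : set V :=
  [set x | [/\ Delta x, hle 0 x & hle x (e - b)]].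

(* Indices are shifted to 0, ..., n - 1: [s k] with k = 0 is the first column
   of the reordered matrix, and for k > 0 it is preceded by k columns. *)
Definition GJF : set vmatrix := [set A | exists s : 'S_n,
  (forall k : 'I_n, k = 0 :> nat -> Ext Delta (A (s k))) /\
  (forall k : 'I_n, (0 < k)%N ->
     Ext (Delta_below (\sum_(j < n | (j < k)%N) A (s j))) (A (s k)))].

End HyperbolicSystem.
Arguments vmatrix {R} V n.

(* The n-fold Cartesian product of V with the topology of the Hilbert norm
   [vnorm S]; as this depends on S, it is attached to an alias indexed by S. *)
Definition vhilbert (R : realType) (V : vectType R) (n : nat)
  (S : hyperbolic_system V n) : Type := vmatrix V n.

HB.instance Definition _ (R : realType) (V : vectType R) (n : nat)
    (S : hyperbolic_system V n) := Choice.copy (vhilbert S) (vmatrix V n).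
HB.instance Definition _ (R : realType) (V : vectType R) (n : nat)
    (S : hyperbolic_system V n) :=
  isOpenTopological.Build (vhilbert S)
    (@vopenT R V n S) (@vopenI R V n S) (@vopen_bigcup R V n S).

(* Main.v *)
(* Along a line x + s y the coefficient of t^k in p(te - x - sy) is a polynomial in s of
   degree at most n - k whose top coefficient is that of p(te - y).  Hence tr is linear and
   |lambda(.)|^2 = tr^2 - 2 e_2 is a quadratic form, so that <.,.> is bilinear without any
   appeal to the deeper theory.  The one analytic input is monotonicity: if x >= 0 and all
   lambda_i(y) > 0, then x + y >= 0 and |lambda(x + y)| >= |lambda(x)|.  Applying
   (1 - eps d/dt)^n makes the roots in t simple for every real s while keeping the degree
   bounds; the n ordered roots are then continuous in s, run from -oo to +oo, and never
   coincide, so each value is taken by all n of them, hence exactly once by each because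
   the level polynomial in s has degree n.  Thus they increase, and eps -> 0 gives the claim.
   It follows that the cone is convex and that <x, y> >= 0 for x, y >= 0.  Part (b) then rests
   on |a_i| <= 1 for columns of trace one, and part (c) on strict convexity of the norm. *)
Require Import Defs.
From HB Require Import structures.
From mathcomp Require Import all_boot all_order all_algebra all_fingroup.
From mathcomp Require Import all_classical all_reals all_analysis.
From mathcomp Require Import complex polyrcf.
From mathcomp Require Import -(notations) mpoly.
From mathcomp Require Import ring lra zify.

Set Implicit Arguments.
Unset Strict Implicit.
Unset Printing Implicit Defensive.

Import Order.TTheory GRing.Theory Num.Theory.
Import numFieldNormedType.Exports.

Local Open Scope classical_set_scope.
Local Open Scope ring_scope.

(** * Real-rooted polynomials *)

Local Notation prod_XsubC rs := (\prod_(r <- rs) ('X - r%:P)).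

(** The operator [1 - eps d/dt] meets four demands at once. It keeps zeros real; it lowers every
    multiplicity above one; its correction has lower total degree in [(s, t)], so the behaviour at
    infinity along the line is intact; and for [eps > 0] it keeps nonnegative roots nonnegative, so
    that the base point stays in the cone. Strict positivity of [y] makes the degree in [s] of the
    level polynomial exact, its top coefficient being up to sign the product of the [lambda_i(y)];
    general [y] are reached through [y + c e]. Roots are not followed down to [eps = 0]: membership
    in the cone is read from the signs of the coefficients, and [|lambda|^2] from Newton's identity,
    and both depend polynomially on [eps]. *)

Lemma horner_prod_XsubC_neq0 (F : fieldType) (rs : seq F) (z : F) :
  z \notin rs -> (prod_XsubC rs).[z] != 0.
Proof. by move=> zrs; rewrite -rootE root_prod_XsubC. Qed.

(** The logarithmic derivative: off its roots, a product is compared with its derivative through the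
    sum of the [(z - r)^-1] alone. *)
Lemma deriv_prod_XsubC (F : fieldType) (rs : seq F) (z : F) : z \notin rs ->
  (prod_XsubC rs)^`().[z] = (prod_XsubC rs).[z] * \sum_(r <- rs) (z - r)^-1.
Proof.
elim: rs => [|r rs IH]; first by rewrite !big_nil derivC hornerC mulr0.
rewrite inE negb_or => /andP[zr zrs].
have zr0 : z - r != 0 by rewrite subr_eq0.
rewrite !big_cons derivM derivXsubC !hornerE IH //.
by field.
Qed.

Section RealRooted.
Context {R : realType}.
Implicit Types (f g h : {poly R}) (rs : seq R) (z r t : R).

Lemma only_real_zeros_neq0 f : only_real_zeros f -> f != 0.
Proof.
move=> rf; apply/eqP => f0.
have : root (map_poly (real_complex R) f) 'i%C by rewrite f0 rmorph0 root0.
by move/rf => /= /eqP; rewrite oner_eq0.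
Qed.

Lemma real_zeros_factor f : only_real_zeros f ->
  exists rs, f = lead_coef f *: prod_XsubC rs.
Proof.
move=> rf; have f0 := only_real_zeros_neq0 rf.
have [zs Ezs] := closed_field_poly_normal (map_poly (real_complex R) f).
exists [seq complex.Re w | w <- zs].
apply: (map_poly_inj (real_complex R)).
rewrite {1}Ezs lead_coef_map map_polyZ /= big_map rmorph_prod.
congr (_ *: _); apply: eq_big_seq => w ws.
rewrite rmorphB /= map_polyX map_polyC /=; congr ('X - _%:P).
have : complex.Im w = 0.
  by apply: rf; rewrite Ezs rootZ ?lead_coef_eq0 ?map_poly_eq0 // root_prod_XsubC.
by case: w {ws} => x y /= ->.
Qed.

Lemma factor_real_zeros rs a : a != 0 ->
  only_real_zeros (a *: prod_XsubC rs).
Proof.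
move=> a0 w; rewrite map_polyZ /= rootZ ?fmorph_eq0 // rmorph_prod /=.
under eq_bigr do rewrite rmorphB /= map_polyX map_polyC /=.
rewrite -(big_map (real_complex R) predT (fun u => 'X - u%:P)) root_prod_XsubC.
by case/mapP => r _ ->.
Qed.

(** Both lists are decreasing and contain each value equally often; from here on [zeros] can be
    treated as a sorted list of roots. *)
Lemma zerosE rs a : a != 0 ->
  zeros (a *: prod_XsubC rs) = sort >=%R rs.
Proof.
move=> a0; set f := a *: _.
have f0 : f != 0.
  by rewrite scaler_eq0 negb_or a0 /= monic_neq0 // monic_prod_XsubC.
have rootf r : root f r = (r \in rs) by rewrite rootZ // root_prod_XsubC.
have mupf r : mup r f = count_mem r rs.
  rewrite -(mu_prod_XsubC r rs) /f -mul_polyC mupMr //.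
  by rewrite rootE hornerC.
have inR r : (r \in rootsR f) = (r \in rs).
  have /(_ r) := roots_on_rootsR f0.
  by rewrite rootf in_itv /= => <-.
have sR : sorted <%R (rootsR f) by exact: sorted_roots.
have uR : uniq (rootsR f).
  exact: (sorted_uniq lt_trans ltxx).
apply: (@sorted_eq _ >=%R); first exact: ge_trans.
- exact: ge_anti.
- rewrite /zeros rev_sorted.
  elim: (rootsR f) sR => //= r l IH pl.
  have sl := IH (path_sorted pl).
  have {}pl : all (fun y => r <= y) (flatten [seq nseq (mup r0 f) r0 | r0 <- l]).
    apply/allP => y /flattenP[s /mapP[r1 r1l ->]].
    rewrite mem_nseq => /andP[_ /eqP ->].
    have /allP/(_ _ r1l) := order_path_min lt_trans pl; exact: ltW.
  elim: (mup r f) => //= m IHm.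
  rewrite (path_sortedE le_trans) IHm andbT all_cat pl andbT.
  by apply/allP => y; rewrite mem_nseq => /andP[_ /eqP ->].
- by apply: sort_sorted => x y; rewrite le_total.
apply/allP => r _ /=; apply/eqP.
rewrite /zeros count_rev count_flatten -map_comp.
have -> : count_mem r (sort >=%R rs) = count_mem r rs.
  by apply/seq.permP; rewrite perm_sort.
rewrite -mupf.
have -> : [seq (count_mem r \o (fun r0 => nseq (mup r0 f) r0)) i | i <- rootsR f] =
          [seq (i == r) * mup r f | i <- rootsR f]%N.
  apply: eq_map => i /=; rewrite count_nseq /=.
  by case: eqP => [->|].
have sum_eq (l : seq R) : (\sum_(i <- l) (i == r) = count_mem r l)%N.
  by rewrite -sum1_count [RHS]big_mkcond; apply: eq_bigr => i _ /=; case: eqP.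
rewrite sumnE big_map -big_distrl /= sum_eq count_uniq_mem // inR mupf.
by case: (boolP (r \in rs)) => [|/count_memPn ->]; rewrite ?mul1n ?muln0.
Qed.
End RealRooted.

(** * Smoothing by the operator 1 - eps d/dt *)

Section Smoothing.
Context {R : realType}.
Implicit Types (f g h : {poly R}) (rs : seq R) (z r t eps : R).

Definition smooth eps f := f - eps *: f^`().

Lemma coef_smooth eps f k : (smooth eps f)`_k = f`_k - eps * f`_k.+1 *+ k.+1.
Proof. by rewrite coefB coefZ coef_deriv mulrnAr. Qed.

(** Each [(w - r)^-1] has imaginary part [- Im w / |w - r|^2], so [q] is the sum of the [|w - r|^-2]
    and nothing cancels. *)
Lemma Im_sum_inv (w : R[i]) rs : complex.Im w != 0 ->
  exists2 q, 0 <= q & (rs != [::] -> 0 < q) /\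
    complex.Im (\sum_(r <- rs) (w - r%:C%C)^-1) = - complex.Im w * q.
Proof.
move=> w0; elim: rs => [|r rs [q q0 [qs Eq]]].
  by exists 0 => //; rewrite big_nil mulr0.
case: w w0 Eq => a b /= b0 Eq.
have pos : 0 < (a - r) ^+ 2 + b ^+ 2.
  by rewrite ltr_wpDl ?sqr_ge0 // lt0r sqrf_eq0 b0 sqr_ge0.
exists (((a - r) ^+ 2 + b ^+ 2)^-1 + q).
  by rewrite addr_ge0 // invr_ge0 ltW.
split; first by move=> _; rewrite ltr_wpDr // invr_gt0.
rewrite big_cons raddfD /= Eq /= subr0 mulrDr; congr (_ + _).
by rewrite mulNr.
Qed.

(* A nonreal zero [w] would satisfy [\sum (w - r)^-1 = eps^-1], but the left side
   has nonzero imaginary part. *)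
Lemma only_real_zeros_smooth eps f : eps != 0 -> only_real_zeros f ->
  only_real_zeros (smooth eps f).
Proof.
move=> eps0 rf; have f0 := only_real_zeros_neq0 rf.
have [rs Ef] := real_zeros_factor rf.
have a0 : lead_coef f != 0 by rewrite lead_coef_eq0.
move=> w; rewrite rootE => /eqP fw; apply/eqP; apply: contraT => w0.
have [q q0 [qs Eq]] := Im_sum_inv rs w0.
pose cs := [seq r%:C%C | r <- rs].
have wcs : w \notin cs by apply: contra w0 => /mapP[r _ ->].
have EF : map_poly (real_complex R) f = (lead_coef f)%:C%C *: prod_XsubC cs.
  rewrite {1}Ef map_polyZ /= rmorph_prod /= big_map; congr (_ *: _).
  by apply: eq_bigr => r _; rewrite rmorphB /= map_polyX map_polyC.
move: fw; rewrite /smooth rmorphB /= map_polyZ /= -deriv_map EF derivZ !(hornerD, hornerN,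
  hornerZ).
rewrite deriv_prod_XsubC //; set P := (prod_XsubC cs).[w].
have -> : \sum_(r <- cs) (w - r)^-1 = \sum_(r <- rs) (w - r%:C%C)^-1 by rewrite big_map.
set S := \sum_(r <- rs) _.
have P0 : P != 0 by exact: horner_prod_XsubC_neq0.
have a0' : (lead_coef f)%:C%C != 0 by rewrite fmorph_eq0.
move=> E; have : (lead_coef f)%:C%C * P * (1 - eps%:C%C * S) = 0.
  by apply: etrans E; ring.
move/eqP; rewrite !mulf_eq0 (negPf a0') (negPf P0) /= subr_eq0 => /eqP ES.
have : complex.Im (eps%:C%C * S) = 0 by rewrite -ES.
have -> : complex.Im (eps%:C%C * S) = eps * complex.Im S.
  by case: (S) => a b /=; rewrite mul0r addr0.
move/eqP; rewrite Eq mulf_eq0 (negPf eps0) mulf_eq0 oppr_eq0 (negPf w0) /=.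
case: (eqVneq rs [::]) qs => [rs0 _ _|_ /(_ isT) /lt0r_neq0 /negPf -> //].
by move: ES; rewrite /S rs0 big_nil mulr0 => /eqP; rewrite oner_eq0.
Qed.

(** Minus the derivative of [P' / P], cleared of denominators. Its positivity excludes double roots
    of the smoothed polynomial away from the roots of [f]. *)
Lemma newton_prod_XsubC rs z : z \notin rs -> let P := prod_XsubC rs in
  P^`().[z] ^+ 2 - P.[z] * P^`()^`().[z] =
  P.[z] ^+ 2 * \sum_(r <- rs) (z - r) ^- 2.
Proof.
elim: rs => [_|r rs IH] /=; first by rewrite !big_nil !derivC !hornerC; ring.
rewrite inE negb_or => /andP[zr zrs]; move: (IH zrs).
rewrite !big_cons; have := hornerXsubC r z; have := derivXsubC r.
set X := 'X - r%:P => dX zX.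
have dM (g : {poly R}) : (X * g)^`() = g + X * g^`() by rewrite derivM dX mul1r.
move: X dX zX dM => X dX zX dM.
rewrite !dM derivD dM !(hornerD, hornerM) zX.
have zr0 : z - r != 0 by rewrite subr_eq0.
set P := (prod_XsubC rs).[z]; set P' := (prod_XsubC rs)^`().[z];
  set P2 := (prod_XsubC rs)^`()^`().[z].
(* For [(X - r) P] the left side equals [P^2 + (X - r)^2 (P'^2 - P P'')], hence this map applied to
   the induction hypothesis. *)
move=> /(congr1 (fun x => P ^+ 2 + (z - r) ^+ 2 * x)) E.
apply: etrans (etrans E _); first by rewrite -/P -/P' -/P2; ring.
rewrite -/P; set S := \sum_(_ <- _) _.
by move: (z - r) (P) (S) zr0 => a b c a0; clear -a0; field.
Qed.

Definition mup_le k f := forall z, (mup z f <= k)%N.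

(** A root of [f] loses exactly one multiplicity and any new root is simple; hence [maxn k 1]. *)
Lemma mup_le_smooth eps f k : eps != 0 -> only_real_zeros f ->
  mup_le k.+1 f -> mup_le (maxn k 1) (smooth eps f).
Proof.
move=> eps0 rf mf z; have f0 := only_real_zeros_neq0 rf.
have h0 := only_real_zeros_neq0 (only_real_zeros_smooth eps0 rf).
case: (boolP (root f z)) => [fz|fz].
  have [m Em] : exists m, mup z f = m.+1.
    by exists (mup z f).-1; rewrite prednK // -XsubC_dvd // dvdp_XsubCl.
  have /dvdpP[q Eq] : ('X - z%:P) ^+ m.+1 %| f by rewrite -mup_geq ?Em.
  have qz : ~~ root q z.
    apply/negP => /factor_theorem [q' Eq'].
    have : (m.+2 <= mup z f)%N by rewrite mup_geq // Eq Eq' -mulrA -exprS dvdp_mull.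
    by rewrite Em ltnn.
  (* At [z] the cofactor takes the value [- eps (m + 1) q(z)], which is nonzero. *)
  have Eh : smooth eps f = (('X - z%:P) * q - eps *: (q *+ m.+1)
      - eps *: (('X - z%:P) * q^`())) * ('X - z%:P) ^+ m.
    rewrite /smooth Eq derivM deriv_exp derivXsubC /= exprS mul1r.
    rewrite -!mul_polyC -(mulr_natr q) -(mulr_natr (('X - z%:P) ^+ m)).
    have gen (Y p p' Z e c : {poly R}) : p * (Y * Z) - e * (p' * (Y * Z) + p * (Z * c))
        = (Y * p - e * (p * c) - e * (Y * p')) * Z by ring.
    exact: gen.
  rewrite Eh mupMr.
    by have := mf z; rewrite Em ltnS mup_XsubCX eqxx leq_max => ->.
  rewrite rootE !(hornerD, hornerN, hornerZ, hornerM, hornerX, hornerC) subrr hornerMn.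
  rewrite !mul0r mulr0 subr0 sub0r oppr_eq0.
  by rewrite mulf_eq0 (negPf eps0) mulrn_eq0 /= -rootE.
(* Off the roots of [f], a double root would give [f = eps f'] and [f' = eps f''] at [z], so the
   left side of [newton_prod_XsubC] would vanish. *)
rewrite leq_max; apply/orP; right; rewrite leqNgt; apply/negP.
rewrite mup_geq // => /dvdpP[q Eq].
have hz : (smooth eps f).[z] = 0 by rewrite Eq expr2 !hornerM hornerXsubC subrr mul0r
  !mulr0.
have h'z : (smooth eps f)^`().[z] = 0.
  by rewrite Eq expr2 !derivM derivXsubC mul1r mulr1 hornerD !hornerM !hornerXsubC hornerD
    hornerXsubC subrr; ring.
have [rs Ef] := real_zeros_factor rf.
have a0 : lead_coef f != 0 by rewrite lead_coef_eq0.
have zrs : z \notin rs by move: fz; rewrite Ef rootZ // root_prod_XsubC.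
have P0 := horner_prod_XsubC_neq0 zrs.
move: hz h'z; rewrite Ef /smooth !(derivB, derivZ) !(hornerD, hornerN, hornerZ).
set P := (prod_XsubC rs).[z]; set P' := (prod_XsubC rs)^`().[z];
  set P2 := (prod_XsubC rs)^`()^`().[z].
move=> hz h'z.
have E1 : P = eps * P'.
  apply: (mulfI a0); apply/eqP; rewrite -subr_eq0 -hz; apply/eqP; ring.
have E2 : P' = eps * P2.
  apply: (mulfI a0); apply/eqP; rewrite -subr_eq0 -h'z; apply/eqP; ring.
have := newton_prod_XsubC zrs; rewrite /= -/P -/P' -/P2.
have -> : P' ^+ 2 - P * P2 = 0 by rewrite {1}E2 E1 E2; ring.
move/esym/eqP; rewrite mulf_eq0 sqrf_eq0 (negPf P0) /=.
(* An empty product has derivative 0, against [P = eps * P'] with [P] nonzero. *)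
have rs0 : rs != [::].
  apply: contraNneq P0 => rs0; rewrite -/P E1 /P' rs0 big_nil.
  by rewrite derivC hornerC mulr0.
case: rs rs0 zrs {Ef P P' P2 hz h'z E1 E2 P0} => // r rs _.
rewrite inE negb_or big_cons => /andP[zr _].
rewrite gt_eqF // ltr_pwDl ?exprn_even_gt0 ?invr_eq0 ?subr_eq0 //.
  by rewrite -exprVn exprn_even_gt0 ?invr_eq0 ?subr_eq0.
by apply: sumr_ge0 => i _; rewrite -exprVn sqr_ge0.
Qed.

Lemma smooth_monic eps f k : f \is monic -> size f = k.+1 ->
  smooth eps f \is monic /\ size (smooth eps f) = k.+1.
Proof.
move=> mf sf; have lt : (size (- (eps *: f^`())) < size f)%N.
  rewrite size_polyN (leq_ltn_trans (size_scale_leq _ _)) // lt_size_deriv //.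
  by rewrite monic_neq0.
split; last by rewrite /smooth size_polyDl.
by rewrite monicE /smooth lead_coefDl.
Qed.

Lemma iter_smooth eps f k n : eps != 0 -> only_real_zeros f -> f \is monic ->
    size f = k.+1 -> let g := iter n (smooth eps) f in
  [/\ only_real_zeros g, g \is monic, size g = k.+1 & mup_le (maxn (k - n) 1) g].
Proof.
move=> eps0 rf mf sf; elim: n => [|n [rg mg sg ug]] /=.
  split=> // z; rewrite leq_max subn0; apply/orP; left.
  have f0 := only_real_zeros_neq0 rf.
  have := dvdp_leq f0; rewrite sf.
  have := mup_geq z (mup z f) f0; rewrite leqnn => /esym d /(_ _ d).
  by rewrite size_exp_XsubC.
have [mg' sg'] := smooth_monic eps mg sg.
split=> //; first exact: only_real_zeros_smooth.
move=> z.
have [kn|kn] := leqP (k - n) 1.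
  have : mup_le 1 (iter n (smooth eps) f).
    by move=> w; apply: leq_trans (ug w) _; rewrite geq_max kn.
  move/(mup_le_smooth (k := 0) eps0 rg)/(_ z) => /= H.
  by apply: leq_trans H _; rewrite leq_max orbT.
have E : maxn (k - n) 1 = (k - n.+1).+1 by lia.
by move: ug; rewrite E => /(mup_le_smooth eps0 rg); apply.
Qed.

Lemma monic_factor f k : only_real_zeros f -> f \is monic -> size f = k.+1 ->
  exists2 rs, f = prod_XsubC rs & size rs = k.
Proof.
move=> rf mf sf; have [rs] := real_zeros_factor rf.
rewrite (monicP mf) scale1r => Ef; exists rs => //.
by apply: succn_inj; rewrite -sf Ef size_prod_XsubC.
Qed.

(** Multiplicities are at most the degree [k], so [k] rounds make every root simple. *)
Lemma iter_smooth_simple eps f k : eps != 0 -> only_real_zeros f -> f \is monic ->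
    size f = k.+1 ->
  exists rs, [/\ iter k (smooth eps) f = prod_XsubC rs, sorted >%R rs & size rs = k].
Proof.
move=> eps0 rf mf sf.
have [rg mg sg ug] := iter_smooth k eps0 rf mf sf.
have [rs Eg srs] := monic_factor rg mg sg.
have srt : perm_eq (sort >=%R rs) rs by rewrite perm_sort.
exists (sort >=%R rs); split.
- by rewrite Eg; apply: perm_big; rewrite perm_sym.
- have us : uniq rs.
    apply: count_mem_uniq => z; have := ug z.
    rewrite Eg mu_prod_XsubC subnn => c1.
    by case: (boolP (z \in rs)) => [zr|/count_memPn //]; apply/eqP;
      rewrite eqn_leq c1 -has_count has_pred1.
  rewrite -[sorted _ _]rev_sorted lt_sorted_uniq_le rev_uniq (perm_uniq srt) us rev_sorted.
  by apply: sort_sorted => x y; rewrite le_total.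
- by rewrite size_sort.
Qed.

End Smoothing.

(** * Families graded by total degree *)

Section Signs.
Context {R : realType}.
Implicit Types (f p : {poly R}) (rs : seq R) (r : R).

Lemma coef_prod_XsubC_cons r rs k : (prod_XsubC (r :: rs))`_k =
  (if k is k'.+1 then (prod_XsubC rs)`_k' else 0) - r * (prod_XsubC rs)`_k.
Proof. by rewrite big_cons mulrBl coefB coefXM coefCM; case: k. Qed.

(** With this sign the coefficient is the elementary symmetric function of degree [size rs - k] in
    the roots, and its recursion is free of subtractions. *)
Lemma sign_coef_prod_XsubC_cons r rs k :
  (-1) ^+ (size (r :: rs) + k) * (prod_XsubC (r :: rs))`_k =
  (if k is k'.+1 then (-1) ^+ (size rs + k') * (prod_XsubC rs)`_k' else 0)
  + r * ((-1) ^+ (size rs + k) * (prod_XsubC rs)`_k).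
Proof.
by rewrite coef_prod_XsubC_cons; case: k => [|k] /=; rewrite !(addSn, addnS, exprS); ring.
Qed.

Lemma coef_prod_XsubC_ge0 rs k : {in rs, forall r, 0 <= r} ->
  0 <= (-1) ^+ (size rs + k) * (prod_XsubC rs)`_k.
Proof.
elim: rs k => [|r rs IH] k rs0.
  by rewrite big_nil coef1; case: k => [|k]; rewrite ?mulr1 ?mulr0.
have r0 : 0 <= r by apply: rs0; rewrite mem_head.
have {}IH j : 0 <= (-1) ^+ (size rs + j) * (prod_XsubC rs)`_j.
  by apply: IH => x xs; apply: rs0; rewrite inE xs orbT.
rewrite sign_coef_prod_XsubC_cons; apply: addr_ge0; last by rewrite mulr_ge0.
by case: k => [|k].
Qed.

Lemma coef_prod_XsubC_gt0 rs k : {in rs, forall r, 0 < r} -> (k <= size rs)%N ->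
  0 < (-1) ^+ (size rs + k) * (prod_XsubC rs)`_k.
Proof.
elim: rs k => [|r rs IH] k rs0; first by case: k => // _; rewrite big_nil coef1 mulr1.
have r0 : 0 < r by apply: rs0; rewrite mem_head.
have rs0' : {in rs, forall r, 0 < r} by move=> x xs; apply: rs0; rewrite inE xs orbT.
move=> ksz; rewrite sign_coef_prod_XsubC_cons.
case: k ksz => [|k] ksz; first by rewrite add0r mulr_gt0 ?IH.
rewrite ltr_wpDr ?IH //; apply: (mulr_ge0 (ltW r0)).
by apply: coef_prod_XsubC_ge0 => x /rs0'/ltW.
Qed.

(** For [r < 0] all powers of [- r] are positive, so coefficients of alternating sign cannot cancel:
    this turns signs of coefficients into locations of roots. *)
Lemma horner_signs n f r : (size f <= n.+1)%N ->
  (-1) ^+ n * f.[r] = \sum_(k < n.+1) ((-1) ^+ (n + k) * f`_k) * (- r) ^+ k.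
Proof.
move=> sf; rewrite (horner_coef_wide _ sf) mulr_sumr; apply: eq_bigr => k _.
rewrite exprD -!mulrA; congr (_ * _); rewrite mulrCA; congr (_ * _).
by rewrite -exprMn mulrN mulN1r opprK.
Qed.

Lemma root_signs_gt0 n f r : (size f <= n.+1)%N ->
  (forall k, (k <= n)%N -> 0 < (-1) ^+ (n + k) * f`_k) -> root f r -> 0 < r.
Proof.
move=> sf fk /eqP fr; rewrite ltNge; apply/negP => r0.
have /eqP := horner_signs r sf; rewrite fr mulr0 eq_sym big_ord_recl /= expr0 mulr1.
rewrite gt_eqF // ltr_wpDr ?fk //; apply: sumr_ge0 => k _.
by rewrite mulr_ge0 ?exprn_ge0 ?oppr_ge0 // ltW // fk.
Qed.

(** The leading coefficient 1 alone keeps the value off zero for [r < 0]. The weak signs make this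
    criterion stable under limits, unlike the strict one. *)
Lemma root_signs_ge0 n f r : f \is monic -> size f = n.+1 ->
  (forall k, (k <= n)%N -> 0 <= (-1) ^+ (n + k) * f`_k) -> root f r -> 0 <= r.
Proof.
move=> mf sf fk /eqP fr; rewrite leNgt; apply/negP => r0.
have sf' : (size f <= n.+1)%N by rewrite sf.
have /eqP := horner_signs r sf'; rewrite fr mulr0 eq_sym big_ord_recr /=.
have -> : f`_n = 1 by rewrite -(monicP mf) lead_coefE sf.
rewrite -signr_odd oddD addbb mulr1 mul1r gt_eqF // ltr_wpDl ?exprn_gt0 ?oppr_gt0 //.
by apply: sumr_ge0 => k _; rewrite mulr_ge0 ?exprn_ge0 ?oppr_ge0 ?(ltW r0) ?fk // ltnW.
Qed.

Lemma root_pos_coef_lt0 n f r : (size f <= n.+1)%N ->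
  (forall k, (k <= n)%N -> 0 < f`_k) -> root f r -> r < 0.
Proof.
move=> sf fk /eqP fr; rewrite ltNge; apply/negP => r0.
have /eqP := horner_coef_wide r sf; rewrite fr eq_sym big_ord_recl /= expr0 mulr1.
rewrite gt_eqF // ltr_wpDr ?fk //; apply: sumr_ge0 => k _.
by rewrite mulr_ge0 ?exprn_ge0 // ltW // fk.
Qed.

Lemma eventually_pos p : 0 < lead_coef p -> exists S, forall x, S <= x -> 0 < p.[x].
Proof.
move=> p0; have [S HS] := poly_pinfty_gt_lc p0.
by exists S => x /HS; exact: lt_le_trans.
Qed.

Lemma eventually_pos_coef p d : (size p <= d.+1)%N -> 0 < p`_d ->
  exists S, forall x, S <= x -> 0 < p.[x].
Proof.
move=> sp pd; apply: eventually_pos; rewrite lead_coefE.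
have -> // : size p = d.+1.
by apply/eqP; rewrite eqn_leq sp ltnNge; apply: contraTN pd => /(nth_default 0) ->;
  rewrite ltxx.
Qed.

Lemma eventually_pos_coef_opp p d : (size p <= d.+1)%N -> 0 < (-1) ^+ d * p`_d ->
  exists S, forall x, S <= x -> 0 < p.[- x].
Proof.
move=> sp pd.
have pd0 : p`_d != 0 by apply: contraTneq pd => ->; rewrite mulr0 ltxx.
have sp' : size p = d.+1.
  by apply/eqP; rewrite eqn_leq sp ltnNge; apply: contraNN pd0 => /(nth_default 0) ->.
have [|S HS] := @eventually_pos (p \Po (- 'X)).
  rewrite lead_coef_comp ?size_polyN ?size_polyX // lead_coefN lead_coefX.
  by rewrite mulrC sp' /= lead_coefE sp'.
by exists S => x /HS; rewrite horner_comp hornerN hornerX.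
Qed.

Lemma eventually_forall n (P : nat -> R -> Prop) :
  (forall k, (k <= n)%N -> exists S, forall x, S <= x -> P k x) ->
  exists S, forall x, S <= x -> forall k, (k <= n)%N -> P k x.
Proof.
elim: n => [|n IH] HP.
  have [S HS] := HP 0%N isT.
  by exists S => x Sx k; rewrite leqn0 => /eqP ->; exact: HS.
have [|S HS] := IH; first by move=> k kn; apply: HP; rewrite leqW.
have [T HT] := HP n.+1 (leqnn _).
exists (Num.max S T) => x; rewrite ge_max => /andP[Sx Tx] k.
by rewrite leq_eqVlt => /orP[/eqP -> | kn]; [exact: HT | exact: HS].
Qed.
End Signs.

Section Graded.
Context {R : realType}.
Implicit Types (F : R -> {poly R}) (h : {poly R}).

(* [(F s).[t]] is a polynomial in [s] and [t] of total degree at most [n], whose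
   homogeneous part of degree [n] is [h] homogenized. *)
Definition graded n F h := exists c : nat -> {poly R},
  [/\ forall s k, (F s)`_k = (c k).[s],
      forall k, (k <= n)%N -> (size (c k) <= (n - k).+1)%N /\ (c k)`_(n - k) = h`_k
    & forall k, (n < k)%N -> c k = 0].

Lemma graded_size n F h s : graded n F h -> (size (F s) <= n.+1)%N.
Proof.
by move=> [c [Fc _ c0]]; apply/leq_sizeP => k nk; rewrite Fc c0 // horner0.
Qed.

(** The derivative lowers the total degree by one, so the correction does not reach the top
    homogeneous part. *)
Lemma graded_smooth n eps F h : graded n F h ->
  graded n (fun s => smooth eps (F s)) h.
Proof.
move=> [c [Fc cn c0]].
have cS k : (size (c k.+1) <= n - k)%N.
  have [kn|nk] := ltnP k n; last by rewrite c0 ?size_poly0.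
  by rewrite -subnSK //; have [] := cn _ kn.
exists (fun k => c k - (eps *+ k.+1) *: c k.+1); split.
- by move=> s k; rewrite coef_smooth !Fc hornerD hornerN hornerZ mulrnAl.
- move=> k kn; have [sk ck] := cn k kn; split.
    rewrite (leq_trans (size_polyD _ _)) // geq_max sk size_polyN /=.
    by rewrite (leq_trans (size_scale_leq _ _)) // leqW.
  by rewrite coefB coefZ (nth_default 0 (cS k)) mulr0 subr0.
- by move=> k nk; rewrite !c0 ?scaler0 ?subr0 // leqW.
Qed.

(** Translating [t] affects only lower-order terms; comparing roots with [T] thus reduces to
    comparing them with 0. *)
Lemma graded_shift n T F h : graded n F h ->
  graded n (fun s => F s \Po ('X + T%:P)) h.
Proof.
move=> gF; have sF := fun s => graded_size s gF; case: gF => c [Fc cn c0].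
have sX i : size (('X + T%:P) ^+ i) = i.+1.
  by rewrite -[T]opprK polyCN size_exp_XsubC.
exists (fun k => \sum_(i < n.+1) (('X + T%:P) ^+ i)`_k *: c i); split.
- move=> s k; rewrite coef_comp_poly horner_sum.
  rewrite (big_ord_widen n.+1 (fun i => (F s)`_i * (('X + T%:P) ^+ i)`_k)) //.
  rewrite big_mkcond; apply: eq_bigr => i _; rewrite hornerZ -Fc mulrC.
  by case: ltnP => // /(nth_default 0) ->; rewrite mulr0.
- move=> k kn; split.
    apply: (leq_trans (size_sum _ _ _)); apply/bigmax_leqP => i _.
    have [ik|ki] := ltnP i k.
      by rewrite nth_default ?sX // scale0r size_poly0.
    apply: (leq_trans (size_scale_leq _ _)).
    have [si _] := cn i (ltnSE (ltn_ord i)).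
    by rewrite (leq_trans si) // ltnS leq_sub2l.
  rewrite coef_sum (bigD1 (Ordinal (kn : (k < n.+1)%N))) //= coefZ.
  have -> : (('X + T%:P) ^+ k)`_k = 1.
    have := lead_coefE (('X + T%:P) ^+ k); rewrite sX /= => <-.
    by rewrite -[T]opprK polyCN (monicP (monic_exp _ (monicXsubC _))).
  rewrite mul1r; have [_ ->] := cn k kn; rewrite big1 ?addr0 // => i ik.
  rewrite coefZ; have [ik'|ki] := ltnP i k.
    by rewrite nth_default ?sX // mul0r.
  have [si _] := cn i (ltnSE (ltn_ord i)).
  rewrite (nth_default _ (leq_trans si _)) ?mulr0 //.
  have ik' : (k < i)%N by rewrite ltn_neqAle ki eq_sym andbT; exact: ik.
  by have := ltn_ord i; lia.
- move=> k nk; rewrite big1 // => i _.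
  by rewrite nth_default ?scale0r // sX (leq_trans _ nk).
Qed.

Lemma graded_iter_smooth n eps m F h : graded n F h ->
  graded n (fun s => iter m (smooth eps) (F s)) h.
Proof. by move=> gF; elim: m => //= m IH; exact: graded_smooth. Qed.

(** The term [h_k s^(n-k)] dominates the [k]-th coefficient, even after the shift by [T]. For large
    [s] the coefficients therefore have the strict signs of a polynomial with positive roots. *)
Lemma graded_roots_pinfty n F hs T : size hs = n -> {in hs, forall r, 0 < r} ->
  graded n F (prod_XsubC hs) ->
  exists S, forall s, S <= s -> forall r, root (F s) r -> T < r.
Proof.
move=> sh h0 /(graded_shift T) gF.
have sF := fun s => graded_size s gF; case: gF => c [Fc cn _].
have [|S HS] := @eventually_forall R n (fun k s => 0 < (-1) ^+ (n + k) * (c k).[s]).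
  move=> k kn; have [sk ck] := cn k kn.
  have [||S HS] := @eventually_pos_coef R ((-1) ^+ (n + k) *: c k) (n - k).
  - exact: leq_trans (size_scale_leq _ _) sk.
  - by rewrite coefZ ck -sh coef_prod_XsubC_gt0 ?sh.
  by exists S => x /HS; rewrite hornerZ.
exists S => s Ss r Fr; rewrite -subr_gt0.
apply: (root_signs_gt0 (sF s)) => [k kn|]; first by rewrite Fc HS.
by rewrite rootE horner_comp !hornerE subrK -rootE.
Qed.

(** For [s] near [-oo] the sign of [s^(n-k)] compensates that of [h_k], so all coefficients are
    positive and every root is negative. *)
Lemma graded_roots_minfty n F hs T : size hs = n -> {in hs, forall r, 0 < r} ->
  graded n F (prod_XsubC hs) ->
  exists S, forall s, s <= S -> forall r, root (F s) r -> r < T.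
Proof.
move=> sh h0 /(graded_shift T) gF.
have sF := fun s => graded_size s gF; case: gF => c [Fc cn _].
have [|S HS] := @eventually_forall R n (fun k s => 0 < (c k).[- s]).
  move=> k kn; have [sk ck] := cn k kn.
  apply: (eventually_pos_coef_opp sk).
  rewrite ck -signr_odd oddB // -oddD signr_odd -sh.
  by apply: coef_prod_XsubC_gt0; rewrite ?sh.
exists (- S) => s Ss r Fr; rewrite -subr_lt0.
apply: (root_pos_coef_lt0 (sF s)) => [k kn|].
  by rewrite Fc -[s]opprK HS // lerNr.
by rewrite rootE horner_comp !hornerE subrK -rootE.
Qed.

(** Bounds by [n] the number of parameters at which a given [t] is a root, as soon as [h] does not
    vanish at 0. *)
Lemma graded_level n F h t : graded n F h -> exists q : {poly R},
  [/\ forall s, q.[s] = (F s).[t], (size q <= n.+1)%N & q`_n = h`_0].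
Proof.
move=> gF; have sF := fun s => graded_size s gF; case: gF => c [Fc cn _].
exists (\sum_(k < n.+1) t ^+ k *: c k); split.
- move=> s; rewrite (horner_coef_wide t (sF s)) horner_sum; apply: eq_bigr => k _.
  by rewrite hornerZ Fc mulrC.
- apply: (leq_trans (size_sum _ _ _)); apply/bigmax_leqP => k _.
  apply: (leq_trans (size_scale_leq _ _)).
  by have [sk _] := cn k (ltnSE (ltn_ord k)); rewrite (leq_trans sk) // ltnS leq_subr.
- rewrite coef_sum big_ord_recl /= coefZ expr0 mul1r.
  have [_] := cn 0%N isT; rewrite subn0 => ->; rewrite big1 ?addr0 // => k _.
  have [|sk _] := cn (lift ord0 k); first by rewrite lift0 ltn_ord.
  rewrite coefZ nth_default ?mulr0 // (leq_trans sk) // lift0.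
  by rewrite subnSK ?ltn_ord // leq_subr.
Qed.

End Graded.

(** * Monotonicity of the roots *)

Section SimpleRoots.
Context {R : realType}.
Implicit Types (F : R -> {poly R}) (hs rs : seq R).

(** Only the factor of [r] changes sign; any other contributes [(r - d - x)(r + d - x) = |x - r|^2 -
    d^2 > 0]. *)
Lemma prod_XsubC_sign_change rs r d : uniq rs -> r \in rs -> 0 < d ->
  (forall x, x \in rs -> x != r -> d < `|x - r|) ->
  (prod_XsubC rs).[r - d] * (prod_XsubC rs).[r + d] < 0.
Proof.
move=> us rrs d0 far; have pr := perm_to_rem rrs.
rewrite (perm_big _ pr) /= big_cons !hornerM !hornerXsubC.
have -> : r - d - r = - d by ring.
have -> : r + d - r = d by ring.
rewrite mulrACA mulNr mulNr oppr_lt0; apply: mulr_gt0; first by rewrite mulr_gt0.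
have {}far : {in rem r rs, forall x, d < `|x - r|}.
  by move=> x; rewrite (rem_filter _ us) mem_filter => /andP[xr xrs]; exact: far.
elim: (rem r rs) far => [|x l IH] far; first by rewrite big_nil !hornerE.
rewrite !big_cons !hornerM !hornerXsubC mulrACA mulr_gt0 //; last first.
  by apply: IH => y yl; apply: far; rewrite inE yl orbT.
have -> : (r - d - x) * (r + d - x) = `|x - r| ^+ 2 - d ^+ 2.
  by rewrite real_normK ?num_real //; ring.
by rewrite subr_gt0 ltr_pXn2r ?nnegrE ?(ltW d0) ?normr_ge0 // far // mem_head.
Qed.

Variables (n : nat) (F : R -> {poly R}) (hs : seq R) (mu : R -> seq R).
Hypotheses (gF : graded n F (prod_XsubC hs)) (sh : size hs = n).
Hypothesis h0 : {in hs, forall r, 0 < r}.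
Hypotheses (Fmu : forall s, F s = prod_XsubC (mu s)) (smu : forall s, size (mu s) = n).
Hypothesis (mus : forall s, sorted >%R (mu s)).

Local Notation m i := (fun s => nth 0 (mu s) i).

Let root_mu s r : root (F s) r = (r \in mu s).
Proof. by rewrite Fmu root_prod_XsubC. Qed.

Let root_m i s : (i < n)%N -> root (F s) (m i s).
Proof. by move=> ilt; rewrite root_mu mem_nth ?smu. Qed.

Let m_lt i j s : (i < j)%N -> (j < n)%N -> m j s < m i s.
Proof.
move=> ij jn; apply: (sorted_ltn_nth (rev_trans lt_trans) 0 (mus s)) => //;
  by rewrite inE smu // (ltn_trans ij).
Qed.

Let m_neq i j s : (i < n)%N -> (j < n)%N -> i != j -> m i s != m j s.
Proof.
by move=> ilt jlt; rewrite neq_ltn => /orP[ij|ij];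
  rewrite ?(lt_eqF (m_lt _ ij _)) ?(gt_eqF (m_lt _ ij _)).
Qed.

Let mu_eq s l : sorted >%R l -> size l = n -> {in l, forall r, root (F s) r} ->
  l = mu s.
Proof.
move=> sl nl lF; apply: (irr_sorted_eq (rev_trans lt_trans) ltxx sl (mus s)).
have ul := sorted_uniq (rev_trans lt_trans) ltxx sl.
have sub : {subset l <= mu s} by move=> x /lF; rewrite root_mu.
by have [|_ E] := uniq_min_size ul sub; first by rewrite smu nl.
Qed.

(** Intervals of radius [d] around the roots at [s0] are disjoint and each still contains a root for
    [s] near [s0]. As there are only [n] roots, these are all of them, in the same order. *)
Lemma sorted_roots_continuous i : (i < n)%N -> continuous (m i).
Proof.
move=> iltn s0; apply/cvgrPdist_lt => /= e e0.
have [d [d0 de dgap]] : exists d, [/\ 0 < d, d < e &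
    forall i j : 'I_n, i != j -> d + d < `|m i s0 - m j s0|].
  have : \forall d \near (0 : R)^'+, [/\ 0 < d, d < e &
    forall i j : 'I_n, i != j -> d + d < `|m i s0 - m j s0|].
    have gap : \forall d \near (0 : R)^'+, forall i j : 'I_n, i != j -> d + d < `|m i s0 -
      m j s0|.
      apply: filter_forall => k; apply: filter_forall => l.
      have [<-|kl] := eqVneq k l; first by near=> d.
      have g0 : 0 < `|m k s0 - m l s0| / 2.
        by rewrite divr_gt0 // normr_gt0 subr_eq0 m_neq.
      near=> d => _; have : d < `|m k s0 - m l s0| / 2 by near: d; exact: nbhs_right_lt.
      by lra.
    near=> d; split; [by [] | by near: d; exact: nbhs_right_lt | by near: d].
  by move=> /filter_ex[d Hd]; exists d.
have rootnear (k : 'I_n) : \forall s \near s0, exists2 r, r \in `](m k s0 - d), (m k s0 +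
  d)[ & root (F s) r.
  have [q1 [E1 _ _]] := graded_level (m k s0 - d) gF.
  have [q2 [E2 _ _]] := graded_level (m k s0 + d) gF.
  (* A sign change between the ends of the interval is an open condition on [s], both values being
     polynomials in [s]. *)
  have neg : (q1 * q2).[s0] < 0.
    rewrite hornerM E1 E2 Fmu; apply: prod_XsubC_sign_change => //.
    - exact: (sorted_uniq (rev_trans lt_trans) ltxx (mus s0)).
    - by rewrite mem_nth ?smu.
    move=> x /(nthP 0)[j]; rewrite smu => jn <- jk.
    have := dgap (Ordinal jn) k; rewrite -val_eqE /=.
    have jk' : j != k by apply: contraNneq jk => ->.
    move=> /(_ jk'); lra.
  near=> s; have : (q1 * q2).[s] < 0.
    by near: s; exact: cvgr_lt (@continuous_horner _ (q1 * q2) s0) 0 neg.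
  rewrite hornerM E1 E2 => ls.
  have lek : m k s0 - d <= m k s0 + d by lra.
  by have [r r1 r2] := poly_ivtoo lek ls; exists r.
near=> s; have Hs : forall k : 'I_n, exists2 r, r \in `](m k s0 - d), (m k s0 + d)[ & root
  (F s) r.
  by near: s; exact: filter_forall rootnear.
have {Hs} /choice[rho Hrho] : forall k : 'I_n, exists r, (r \in `](m k s0 - d), (m k s0 +
  d)[) /\ root (F s) r.
  by move=> k; have [r] := Hs k; exists r.
have Emu : [seq rho k | k <- enum 'I_n] = mu s.
  apply: mu_eq; last by move=> r /mapP[k _ ->]; exact: (Hrho k).2.
  - rewrite (@sorted_map _ _ rho).
    apply: (@sub_sorted _ (fun k l : 'I_n => (k < l)%N)) => [k l kl /=|].
      have := m_lt s0 kl (ltn_ord l).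
      have := dgap k l; rewrite neq_ltn kl /= => /(_ isT).
      have [+ _] := Hrho k; have [+ _] := Hrho l; rewrite !in_itv /=.
      move=> /andP[_ h1] /andP[h2 _] + h3.
      rewrite ger0_norm ?subr_ge0 1?ltW // => h4; lra.
    by rewrite -(@sorted_map _ _ val ltn) val_enum_ord iota_ltn_sorted.
  - by rewrite size_map size_enum_ord.
have -> : m i s = rho (Ordinal iltn).
  by rewrite -Emu (nth_map (Ordinal iltn)) ?size_enum_ord // (nth_ord_enum _ (Ordinal
    iltn)).
have [+ _] := Hrho (Ordinal iltn); rewrite in_itv /= => /andP[h1 h2].
by rewrite ltr_norml; apply/andP; split; lra.
Unshelve. all: by end_near.
Qed.

Let m_hits_above i v b : (i < n)%N -> m i b <= v -> exists2 s, b <= s & m i s = v.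
Proof.
move=> iltn mb.
have [S HS] := graded_roots_pinfty v sh h0 gF.
pose c := Num.max b S.
have bc : b <= c by rewrite le_max lexx.
have mc : v < m i c by apply: (HS c) (root_m c iltn); rewrite le_max lexx orbT.
have [||s] := @IVT R (m i) b c v bc.
- by apply: continuous_subspaceT; exact: sorted_roots_continuous.
- by rewrite ge_min mb le_max (ltW mc) orbT.
by rewrite in_itv /= => /andP[bs _] ms; exists s.
Qed.

Let m_hits i v : (i < n)%N -> exists s, m i s = v.
Proof.
move=> iltn; have [S HS] := graded_roots_minfty v sh h0 gF.
have [|s _ ms] := @m_hits_above i v S iltn; last by exists s.
by apply: ltW; apply: (HS S) (root_m S iltn).
Qed.

(* Each root curve takes the value [v]; two hits by the same curve would give
   the level polynomial [s |-> (F s).[v]] of degree [n] more than [n] zeros. *)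
Lemma sorted_roots_mono i a b : (i < n)%N -> a <= b -> m i a <= m i b.
Proof.
move=> iltn; rewrite le_eqVlt => /predU1P[->//|ab].
rewrite leNgt; apply/negP => /ltW mab.
set v := m i a in mab.
(* A curve that drops below [v] must return to [v] at some [s' >= b], since it tends to [+oo]. *)
have [s' bs' ms'] := m_hits_above iltn mab.
have /choice[t Ht] : forall j : 'I_n, exists s, m j s = v /\ (j = i :> nat -> s != a).
  move=> j; have [ji|ji] := eqVneq (j : nat) i.
    exists s'; split; [by rewrite ji | move=> _].
    by rewrite gt_eqF // (lt_le_trans ab).
  have [s ms] := m_hits v (ltn_ord j); exists s; split=> // jei.
  by rewrite jei eqxx in ji.
have [q [Eq sq qn]] := graded_level v gF.
(* The coefficient of [s^n] is the constant term of the product over [hs], nonzero because all its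
   roots are positive. *)
have q0 : q != 0.
  apply/eqP => q0; move: qn; rewrite q0 coef0 => /esym/eqP.
  rewrite -horner_coef0 -rootE root_prod_XsubC => /h0.
  by rewrite ltxx.
have := @max_poly_roots R q (a :: [seq t j | j <- enum 'I_n]) q0.
rewrite /= size_map size_enum_ord ltnNge sq => H.
suff : ~~ true by [].
apply: H.
  apply/andP; split; first by rewrite rootE Eq -rootE; exact: root_m.
  apply/allP => x /mapP[j _ ->]; rewrite rootE Eq -rootE.
  by have [<- _] := Ht j; exact: root_m.
(* The [n + 1] parameters are distinct: at one parameter two curves cannot both equal [v], and curve
   [i] was given a hit other than [a]. *)
apply/andP; split.
  apply/mapP => -[j _ aj]; have [mj tj] := Ht j.
  have ji : j = i :> nat.
    apply/eqP; apply: contraT => /(m_neq a (ltn_ord j) iltn).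
    by rewrite {1}aj mj eqxx.
  by have := tj ji; rewrite aj eqxx.
rewrite map_inj_uniq ?enum_uniq // => j k tjk.
apply/val_inj/eqP; apply: contraT => /(m_neq (t j) (ltn_ord j) (ltn_ord k)).
by have [-> _] := Ht j; rewrite tjk; have [-> _] := Ht k; rewrite eqxx.
Qed.

End SimpleRoots.

(** * Power sums through coefficients, and the limit of vanishing smoothing *)

Section Monotone.
Context {R : realType}.
Implicit Types (F : R -> {poly R}) (f q : {poly R}) (hs rs : seq R).

(* The factor ['X^2] makes the two coefficients below the leading one available
   in every degree, including 0 and 1. *)
Lemma coefX2M_prod_XsubC rs : ('X^2 * prod_XsubC rs)`_(size rs).+2 = 1.
Proof.
rewrite coefXnM subn2 /= -(monicP (monic_prod_XsubC rs xpredT id)) lead_coefE.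
by rewrite size_prod_XsubC.
Qed.

Lemma sum_prod_XsubC rs :
  \sum_(r <- rs) r = - ('X^2 * prod_XsubC rs)`_(size rs).+1.
Proof.
elim: rs => [|r rs IH]; first by rewrite !big_nil mulr1 coefXn oppr0.
rewrite !big_cons IH mulrCA mulrBl coefB coefXM coefCM /= coefX2M_prod_XsubC.
by rewrite mulr1 opprB addrC.
Qed.

(** Newton's identity [p_2 = e_1^2 - 2 e_2], which makes the squared norm a polynomial in the
    coefficients. *)
Lemma sum_sqr_prod_XsubC rs : let f := 'X^2 * prod_XsubC rs in
  \sum_(r <- rs) r ^+ 2 = f`_(size rs).+1 ^+ 2 - 2 * f`_(size rs).
Proof.
elim: rs => [|r rs /= IH] /=.
  by rewrite !big_nil mulr1 !coefXn /= expr0n mulr0 subr0.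
rewrite !big_cons IH mulrCA mulrBl !coefB !coefXM !coefCM /=.
rewrite coefX2M_prod_XsubC; ring.
Qed.

Lemma smooth0 f : smooth 0 f = f.
Proof. by rewrite /smooth scale0r subr0. Qed.

(** Lets the limit [eps -> 0] be taken coefficientwise, as the value of a polynomial at 0. *)
Lemma coef_iter_smooth m f k : exists q : {poly R},
  forall eps, (iter m (smooth eps) f)`_k = q.[eps].
Proof.
elim: m k => [|m IH] k /=; first by exists (f`_k)%:P => eps; rewrite hornerC.
have [q1 E1] := IH k; have [q2 E2] := IH k.+1.
exists (q1 - 'X * q2 *+ k.+1) => eps.
by rewrite coef_smooth E1 E2 hornerD hornerN hornerMn hornerM hornerX.
Qed.

Lemma horner0_ge0 q : (forall eps, 0 < eps -> 0 <= q.[eps]) -> 0 <= q.[0].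
Proof.
move=> q0; rewrite leNgt; apply/negP => qlt.
have neg : \forall eps \near (0 : R)^'+, q.[eps] < 0.
  apply: (cvgr_lt q.[0]) => //.
  by apply: cvg_at_right_filter; exact: continuous_horner.
have /filter_ex[eps [e0]] : \forall eps \near (0 : R)^'+, 0 < eps /\ q.[eps] < 0.
  by near=> eps; split; [by [] | near: eps].
by rewrite ltNge q0.
Unshelve. all: by end_near.
Qed.

(** A root [r < 0] would need [eps] times the sum of the [(r - x)^-1] to be 1, but all these terms
    are negative. This is what fixes the sign of [eps]. *)
Lemma root_smooth_ge0 eps rs : 0 < eps -> {in rs, forall r, 0 <= r} ->
  forall r, root (smooth eps (prod_XsubC rs)) r -> 0 <= r.
Proof.
move=> e0 rs0 r; rewrite leNgt => Er; apply/negP => r0.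
have rrs : r \notin rs by apply: contraL r0 => /rs0; rewrite leNgt.
move: Er; rewrite rootE /smooth hornerD hornerN hornerZ deriv_prod_XsubC //.
rewrite mulrCA -[X in X - _]mulr1 -mulrBr mulf_eq0.
rewrite (negPf (horner_prod_XsubC_neq0 rrs)) /= subr_eq0 => /eqP E.
have : 0 <= eps * - \sum_(x <- rs) (r - x)^-1.
  rewrite mulr_ge0 ?(ltW e0) // -sumrN big_seq sumr_ge0 // => x /rs0 x0.
  by rewrite -invrN invr_ge0 opprB subr_ge0 (le_trans (ltW r0)).
by rewrite mulrN -E oppr_ge0 ler10.
Qed.

Lemma root_iter_smooth_ge0 eps rs m : 0 < eps -> {in rs, forall r, 0 <= r} ->
  forall r, root (iter m (smooth eps) (prod_XsubC rs)) r -> 0 <= r.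
Proof.
move=> e0; have e1 : eps != 0 by rewrite gt_eqF.
move=> rs0.
have mf := monic_prod_XsubC rs xpredT id.
have rf : only_real_zeros (prod_XsubC rs).
  by rewrite -[X in only_real_zeros X]scale1r; apply: factor_real_zeros; exact: oner_neq0.
elim: m => [|m IH] r /=; first by rewrite root_prod_XsubC => /rs0.
have [rg mg sg _] := iter_smooth m e1 rf mf (size_prod_XsubC rs id).
have [l El _] := monic_factor rg mg sg.
move: IH; rewrite El => IH; apply: root_smooth_ge0 => // x xl.
by apply: IH; rewrite root_prod_XsubC.
Qed.

(** For [eps > 0] the simple roots are compared one by one. Both conclusions are closed conditions
    on coefficients that are polynomial in [eps], so they survive at [eps = 0]. *)
Lemma graded_mono n F hs a b ra rb : size hs = n -> {in hs, forall r, 0 < r} ->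
  graded n F (prod_XsubC hs) ->
  (forall s, [/\ only_real_zeros (F s), F s \is monic & size (F s) = n.+1]) ->
  a <= b -> F a = prod_XsubC ra -> F b = prod_XsubC rb ->
  {in ra, forall r, 0 <= r} ->
  {in rb, forall r, 0 <= r} /\ \sum_(r <- ra) r ^+ 2 <= \sum_(r <- rb) r ^+ 2.
Proof.
move=> sh h0 gF HF ab Fa Fb ra0.
have sra : size ra = n by apply: succn_inj; have [_ _ <-] := HF a;
  rewrite Fa size_prod_XsubC.
have srb : size rb = n by apply: succn_inj; have [_ _ <-] := HF b;
  rewrite Fb size_prod_XsubC.
pose T eps s := iter n (smooth eps) (F s).
have main eps : 0 < eps -> exists la lb, [/\ T eps a = prod_XsubC la,
   T eps b = prod_XsubC lb, size la = n, size lb = n & {in lb, forall r, 0 <= r} /\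
   \sum_(r <- la) r ^+ 2 <= \sum_(r <- lb) r ^+ 2].
  move=> e0; have e1 : eps != 0 by rewrite gt_eqF.
  have /choice[mu Hmu] : forall s, exists l, [/\ T eps s = prod_XsubC l, sorted >%R l &
    size l = n].
    by move=> s; have [rs ms ss] := HF s; exact: iter_smooth_simple.
  have gT := graded_iter_smooth eps n gF.
  have Tmu s : T eps s = prod_XsubC (mu s) by have [] := Hmu s.
  have mus s : sorted >%R (mu s) by have [] := Hmu s.
  have smu s : size (mu s) = n by have [] := Hmu s.
  have mono i (iltn : (i < n)%N) := sorted_roots_mono gT sh h0 Tmu smu mus iltn ab.
  have mua0 : {in mu a, forall r, 0 <= r}.
    move=> r rmu; apply: (root_iter_smooth_ge0 (m := n) e0 ra0).
    by rewrite -Fa -/(T eps a) Tmu root_prod_XsubC.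
  have a0 i : (i < n)%N -> 0 <= nth 0 (mu a) i.
    by move=> iltn; apply: mua0; rewrite mem_nth ?smu.
  exists (mu a), (mu b); split=> //; split.
    move=> r rmu; rewrite -(nth_index 0 rmu).
    have iltn : (index r (mu b) < n)%N by rewrite -(smu b) index_mem.
    exact: le_trans (a0 _ iltn) (mono _ iltn).
  rewrite [leLHS](big_nth 0) [leRHS](big_nth 0) !smu [leLHS]big_nat [leRHS]big_nat;
    apply: ler_sum => i /= iltn.
  by rewrite ler_pXn2r ?mono ?nnegrE ?a0 // (le_trans (a0 _ iltn)) ?mono.
have T0 s : T 0 s = F s by rewrite /T; elim: {1}n => //= m ->; rewrite smooth0.
split.
  have [_ mb sb] := HF b.
  have sgn k : 0 <= (-1) ^+ (n + k) * (F b)`_k.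
    have [q Eq] := coef_iter_smooth n (F b) k.
    rewrite -(T0 b) /T Eq -hornerZ; apply: horner0_ge0 => eps e0.
    rewrite hornerZ -Eq -/(T eps b); have [la [lb [_ -> _ <- [lb0 _]]]] := main eps e0.
    exact: coef_prod_XsubC_ge0.
  move=> r rrb; apply: (root_signs_ge0 mb sb (fun k _ => sgn k)).
  by rewrite Fb root_prod_XsubC.
have XE s k : exists q : {poly R}, forall eps, ('X^2 * T eps s)`_k = q.[eps].
  have [k2|k2] := ltnP k 2; first by exists 0 => eps; rewrite coefXnM k2 hornerC.
  have [q Eq] := coef_iter_smooth n (F s) (k - 2).
  by exists q => eps; rewrite coefXnM ltnNge k2 /= Eq.
have [q1 E1] := XE a n.+1; have [q2 E2] := XE a n.
have [q3 E3] := XE b n.+1; have [q4 E4] := XE b n.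
have := sum_sqr_prod_XsubC ra; have := sum_sqr_prod_XsubC rb.
rewrite /= sra srb -Fa -Fb -(T0 a) -(T0 b) E1 E2 E3 E4 => -> ->.
rewrite -subr_ge0.
(* The difference of the two sums of squares, as a polynomial in [eps]. *)
pose q := q3 ^+ 2 - 2 *: q4 - (q1 ^+ 2 - 2 *: q2).
have qE x : q.[x] = q3.[x] ^+ 2 - 2 * q4.[x] - (q1.[x] ^+ 2 - 2 * q2.[x]).
  by rewrite /q !(hornerD, hornerN, hornerZ, horner_exp).
rewrite -qE; apply: horner0_ge0 => eps e0; rewrite qE subr_ge0.
have [la [lb [Ea Eb sla slb [_ le]]]] := main eps e0.
have := sum_sqr_prod_XsubC la; have := sum_sqr_prod_XsubC lb.
by rewrite /= sla slb -Ea -Eb E1 E2 E3 E4 => <- <-.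
Qed.

End Monotone.

(** * Hyperbolic systems *)

Section PencilLines.
Context {R : realType} {V : vectType R}.
Implicit Types (p : polynomial_on V) (e x y : V) (f g : {poly R}).

(** The test points [1, ..., size (f - g)] avoid 0, so identities may be checked after inverting the
    variable. *)
Lemma poly_ext f g : (forall t, t != 0 -> f.[t] = g.[t]) -> f = g.
Proof.
move=> fg; apply/eqP; rewrite -subr_eq0; apply: contraT => h0.
have u : uniq [seq (i.+1%:R : R) | i <- iota 0 (size (f - g))].
  rewrite map_inj_uniq ?iota_uniq // => i j /eqP; rewrite eqr_nat.
  by move=> /eqP[].
have := max_poly_roots h0 _ u; rewrite size_map size_iota ltnn => -> //.
apply/allP => r /mapP[i _ ->].
by rewrite rootE hornerD hornerN fg ?subrr // pnatr_eq0.
Qed.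

Lemma peval_scale n p c x : homogeneous n p -> peval p (c *: x) = c ^+ n * peval p x.
Proof.
move=> hp; rewrite /peval !mevalE mulr_sumr; apply: eq_big_seq => m mp.
have <- : mdeg m = n by have /allP/(_ _ mp)/eqP := hp.
rewrite mulrCA; congr (_ * _).
rewrite mdegE -prodrXr -big_split /=; apply: eq_bigr => i _.
by rewrite /coords linearZ exprMn.
Qed.

Lemma coef_pencil_line p e x y k : exists c : {poly R},
  forall s, (pencil p e (x + s *: y))`_k = c.[s].
Proof.
(* The pencil over [R[s]], with [t] as outer variable; evaluating its coefficients at [s] is a ring
   morphism that gives back the pencil at [x + s *: y]. *)
pose G : {poly {poly R}} := mmap (@polyC _ \o @polyC R)
  (fun i => (coords e i)%:P *: 'X - ((coords x i)%:P + coords y i *: 'X)%:P) p.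
exists G`_k => s; rewrite -[RHS]/(horner_eval s G`_k) -coef_map.
congr (nth 0 (polyseq _) k).
rewrite /pencil /G /mmap rmorph_sum; apply: eq_bigr => m _.
rewrite rmorphM; congr (_ * _); first by rewrite /= map_polyC /= /horner_eval hornerC.
rewrite /mmap1 rmorph_prod; apply: eq_bigr => i _.
rewrite rmorphXn rmorphB /= map_polyZ map_polyX map_polyC /= /horner_eval.
by rewrite !hornerE /coords linearD linearZ /= [_ * s]mulrC.
Qed.

Lemma coef_comp_scaleX f c k : (f \Po (c *: 'X))`_k = c ^+ k * f`_k.
Proof.
rewrite coef_comp_poly.
under eq_bigr do rewrite exprZn coefZ coefXn.
have [kf|fk] := ltnP k (size f).
  rewrite (bigD1 (Ordinal kf)) //= eqxx mulr1 mulrC big1 ?addr0 // => i.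
  by rewrite -val_eqE /= eq_sym => /negPf ->; rewrite !mulr0.
rewrite [in RHS]nth_default // mulr0 big1 // => i _.
by rewrite gtn_eqF ?mulr0 // (leq_trans (ltn_ord i)).
Qed.

Lemma coef_pencil_scale n p e x c k : homogeneous n p ->
  c ^+ k * (pencil p e (c *: x))`_k = c ^+ n * (pencil p e x)`_k.
Proof.
move=> hp; rewrite -coef_comp_scaleX -coefZ; congr (nth 0 (polyseq _) k).
apply: poly_ext => t _; rewrite horner_comp !hornerZ !horner_pencil hornerX.
rewrite -(peval_scale _ _ hp) scalerBr; by rewrite scalerA.
Qed.

Lemma coef_reciprocal f g k n :
  (forall s, s != 0 -> f.[s] * s ^+ k = s ^+ n * g.[s^-1]) ->
  forall i, f`_i = if (i + k <= n)%N then g`_(n - (i + k)) else 0.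
Proof.
move=> fg i; pose m := size g.
(* The extra factor [X^m] clears the negative powers in [g(1/s)]. *)
have E : f * 'X^(k + m) = \sum_(j < m) g`_j *: 'X^(n + m - j).
  apply: poly_ext => s s0; rewrite hornerM hornerXn exprD mulrA fg //.
  rewrite horner_sum (horner_coef_wide _ (leqnn m)) mulr_sumr mulr_suml.
  apply: eq_bigr => j _; rewrite hornerZ hornerXn mulrCA -!mulrA; congr (_ * _).
  rewrite -addnBA 1?ltnW // exprD; congr (_ * _).
  have -> : s ^+ m = s ^+ j * s ^+ (m - j) by rewrite -exprD subnKC // ltnW.
  by rewrite mulrA -exprMn mulVf // expr1n mul1r.
have := congr1 (fun h : {poly R} => h`_(i + (k + m))) E.
rewrite coefMXn ltnNge leq_addl /= addnK => ->.
rewrite coef_sum; under eq_bigr do rewrite coefZ coefXn.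
have [ikn|ikn] := leqP (i + k) n.
  have [jm|mj] := ltnP (n - (i + k)) m.
    rewrite (bigD1 (Ordinal jm)) //= big1 ?addr0 => [|j].
      have -> : (i + (k + m) == n + m - (n - (i + k)))%N by lia.
      by rewrite mulr1.
    rewrite -val_eqE /= => jne; case: eqP; rewrite ?mulr0 // => H; exfalso.
    move/eqP: jne; apply; have := ltn_ord j; lia.
  rewrite nth_default // big1 // => j _; case: eqP; rewrite ?mulr0 // => H.
  exfalso; have := ltn_ord j; lia.
rewrite big1 // => j _; case: eqP; rewrite ?mulr0 // => H.
exfalso; have := ltn_ord j; lia.
Qed.

(** As [x + s y = s (y + s^-1 x)], each coefficient along the line is the reversal of the one along
    [y + s x]. This bounds its degree, and its top coefficient is the value at [s = 0] of the
    latter, hence at [y]. *)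
Lemma graded_pencil n p e x y : homogeneous n p ->
  graded n (fun s => pencil p e (x + s *: y)) (pencil p e y).
Proof.
move=> hp.
have /choice[c Hc] := coef_pencil_line p e x y.
have /choice[d Hd] := coef_pencil_line p e y x.
have cd k i : (c k)`_i = if (i + k <= n)%N then (d k)`_(n - (i + k)) else 0.
  apply: (@coef_reciprocal (c k) (d k) k n) => s s0; rewrite -Hc -Hd mulrC.
  rewrite -(coef_pencil_scale _ _ _ _ hp) scalerDr scalerA mulfV // scale1r.
  by rewrite [s *: y + x]addrC.
exists c; split=> [s k|k kn|k nk]; first by rewrite Hc.
- split.
    apply/leq_sizeP => i ni; rewrite cd leqNgt.
    by have -> : (n < i + k)%N by lia.
  rewrite cd subnK // leqnn subnn -horner_coef0 -Hd.
  by rewrite scale0r addr0.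
apply/polyP => i; rewrite cd coef0 leqNgt.
by have -> : (n < i + k)%N by lia.
Qed.

End PencilLines.

Section GradedMore.
Context {R : realType}.
Implicit Types (F : R -> {poly R}) (h : {poly R}).

Lemma graded_scale n a F h : graded n F h ->
  graded n (fun s => a *: F s) (a *: h).
Proof.
move=> [c [Fc cn c0]]; exists (fun k => a *: c k); split.
- by move=> s k; rewrite coefZ Fc hornerZ.
- move=> k kn; have [sk ck] := cn k kn; rewrite !coefZ ck; split=> //.
  exact: leq_trans (size_scale_leq _ _) sk.
- by move=> k /c0 ->; rewrite scaler0.
Qed.

Lemma graded_X2M n F h : graded n F h ->
  graded n.+2 (fun s => 'X^2 * F s) ('X^2 * h).
Proof.
move=> [c [Fc cn c0]]; exists (fun k => if (k < 2)%N then 0 else c (k - 2)%N); split.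
- by move=> s k; rewrite coefXnM; case: ifP => _; rewrite ?hornerC.
- move=> k kn; rewrite coefXnM; case: ltnP => k2; first by rewrite size_poly0 coef0.
  have := cn (k - 2)%N; have -> : (n - (k - 2) = n.+2 - k)%N by lia.
  by apply; lia.
- move=> k nk; case: ltnP => // k2; apply: c0; lia.
Qed.

Lemma graded_linear n F h s : graded n.+1 F h -> (F s)`_n = (F 0)`_n + s * h`_n.
Proof.
move=> [c [Fc cn _]]; have [sc ch] := cn n (leqnSn n).
rewrite !Fc; move: sc ch; rewrite subSnn => sc <-.
by rewrite (horner_coef_wide s sc) (horner_coef_wide 0 sc) !big_ord_recl !big_ord0 /=; ring.
Qed.

Lemma graded_quadratic n F h : graded n.+2 F h ->
  exists b, forall s, (F s)`_n = (F 0)`_n + s * b + s ^+ 2 * h`_n.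
Proof.
move=> [c [Fc cn _]]; have [|sc ch] := cn n; first by rewrite leqW.
exists (c n)`_1 => s; rewrite !Fc; move: sc ch.
have -> : (n.+2 - n = 2)%N by lia.
move=> sc <-; rewrite (horner_coef_wide s sc) (horner_coef_wide 0 sc).
by rewrite !big_ord_recl !big_ord0 /=; ring.
Qed.

End GradedMore.

(** * Bilinear form of a function that is quadratic along lines *)

Section Polarization.
Context {R : realFieldType} {V : lmodType R}.
Variable q : V -> R.
Hypothesis q_line : forall x y, exists b, forall s,
  q (x + s *: y) = q x + s * b + s ^+ 2 * q y.

(** Has the exact shape of [inner], so that [innerE] holds by conversion. *)
Definition polar x y := 4^-1 * (q (x + y) - q (x - y)).

Lemma quad_line x y s : q (x + s *: y) = q x + s * (2 * polar x y) + s ^+ 2 * q y.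
Proof.
have [b Hb] := q_line x y; rewrite Hb; congr (_ + _ + _); congr (_ * _).
have := Hb 1; have := Hb (- 1); rewrite scale1r scaleN1r /polar => -> ->.
by field.
Qed.

Lemma quad0 : q 0 = 0.
Proof.
have := quad_line 0 0 1; have := quad_line 0 0 (- 1).
rewrite !scaler0 !addr0; lra.
Qed.

Lemma quadN x : q (- x) = q x.
Proof.
have := quad_line 0 x (- 1); rewrite scaleN1r /polar !add0r quad0; lra.
Qed.

Lemma polarC x y : polar x y = polar y x.
Proof. by rewrite /polar (addrC x y) -(quadN (x - y)) opprB. Qed.

Lemma polar0l y : polar 0 y = 0.
Proof. by rewrite /polar add0r sub0r quadN subrr mulr0. Qed.

Lemma polarZr s x y : polar x (s *: y) = s * polar x y.
Proof.
have qs : q (s *: y) = s ^+ 2 * q y.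
  by have := quad_line 0 y s; rewrite add0r quad0 polar0l => ->; ring.
have := quad_line x y s; have := quad_line x (s *: y) 1; rewrite scale1r qs => ->.
lra.
Qed.

Lemma parallelogram x y : q (x + y) + q (x - y) = 2 * (q x + q y).
Proof.
have := quad_line x y 1; have := quad_line x y (- 1).
by rewrite scale1r scaleN1r => -> ->; ring.
Qed.

Lemma polarZl s x y : polar (s *: x) y = s * polar x y.
Proof. by rewrite polarC polarZr polarC. Qed.

(** The argument of Jordan and von Neumann: [q_line] sees one direction at a time, and the
    parallelogram law, applied to half the sum and half the difference, links two. *)
Lemma polarDl x z y : polar (x + z) y = polar x y + polar z y.
Proof.
have key u v : polar (u + v) y + polar (u - v) y = 2 * polar u y.
  have := parallelogram (u + y) v; have := parallelogram (u - y) v.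
  rewrite /polar (addrAC u y v) (addrAC u y (- v)) (addrAC u (- y) v) (addrAC u (- y) (-
    v)).
  lra.
pose u := 2^-1 *: (x + z); pose v := 2^-1 *: (x - z).
have half w : w = 2^-1 *: w + 2^-1 *: w :> V.
  by rewrite -scalerDl [X in X *: _](_ : _ = 1) ?scale1r //; lra.
have -> : polar (x + z) y = 2 * polar u y by rewrite polarZl; field.
rewrite -(key u v) /u /v; congr (polar _ y + polar _ y).
  by rewrite -scalerDr addrACA subrr addr0 scalerDr -half.
by rewrite -scalerBr opprB (addrC x z) addrACA subrr addr0 scalerDr -half.
Qed.

Lemma polarxx x : polar x x = q x.
Proof.
have := quad_line x x (- 1); rewrite scaleN1r subrr quad0; lra.
Qed.

Lemma polarNl x y : polar (- x) y = - polar x y.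
Proof. by rewrite -scaleN1r polarZl mulN1r. Qed.

Lemma polarBl x z y : polar (x - z) y = polar x y - polar z y.
Proof. by rewrite polarDl polarNl. Qed.

Lemma polarDr x y z : polar x (y + z) = polar x y + polar x z.
Proof. by rewrite polarC polarDl !(polarC x). Qed.

Lemma polar_suml I (r : seq I) (f : I -> V) y :
  polar (\sum_(i <- r) f i) y = \sum_(i <- r) polar (f i) y.
Proof.
by elim/big_rec2: _ => [|i a b _ <-]; rewrite ?polar0l ?polarDl.
Qed.

Lemma polar_sumr I (r : seq I) (f : I -> V) y :
  polar y (\sum_(i <- r) f i) = \sum_(i <- r) polar y (f i).
Proof.
by rewrite polarC polar_suml; apply: eq_bigr => i _; exact: polarC.
Qed.

Lemma quadB x y : q (x - y) = q x - 2 * polar x y + q y.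
Proof. by have := quad_line x y (- 1); rewrite scaleN1r => ->; ring. Qed.

Lemma quadD x y : q (x + y) = q x + 2 * polar x y + q y.
Proof. by have := quad_line x y 1; rewrite scale1r => ->; ring. Qed.

End Polarization.

(** * Spectrum, trace and squared norm *)

Section HyperbolicSystem.
Context {R : realType} {V : vectType R} {n : nat}.
Variable S : hyperbolic_system V n.
Implicit Types (x y : V).

Local Notation e := (hunit S).
Local Notation pe := (peval (hpoly S) e).
Local Notation pencilS := (pencil (hpoly S) e).

Definition monic_pencil x := pe^-1 *: pencilS x.
Definition spectrum x := zeros (pencilS x).
Definition sq x := sqnorm (lambda S x).

Let pe0 : pe != 0. Proof. exact: hpoly_unit_neq0. Qed.

Let gP x y := graded_pencil e x y (hpoly_homogeneous S).

(** This coefficient has degree 0 along every line, so it can be computed at [x = 0], where the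
    pencil is [p(e) t^n]. *)
Lemma coef_pencil_lead x : (pencilS x)`_n = pe.
Proof.
have const y z : (pencilS y)`_n = (pencilS z)`_n.
  have [c [Fc cn _]] := gP y z; have [sc ch] := cn n (leqnn n).
  have := Fc 0 n; rewrite scale0r addr0 => ->; rewrite -ch subnn.
  by move: sc; rewrite subnn => /size1_polyC ->; rewrite hornerC coefC eqxx.
rewrite (const x 0); have -> : pencilS 0 = pe *: 'X^n.
  apply: poly_ext => t _; rewrite horner_pencil subr0 (peval_scale _ _ (hpoly_homogeneous
    S)).
  by rewrite hornerZ hornerXn mulrC.
by rewrite coefZ coefXn eqxx mulr1.
Qed.

Lemma size_pencil x : size (pencilS x) = n.+1.
Proof.
have := graded_size 0 (gP x 0); rewrite scale0r addr0 => le.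
apply/eqP; rewrite eqn_leq le ltnNge; apply: contra pe0 => /(nth_default 0) <-.
by rewrite coef_pencil_lead.
Qed.

Lemma monic_pencilP x :
  [/\ only_real_zeros (monic_pencil x), monic_pencil x \is monic & size (monic_pencil x) =
    n.+1].
Proof.
have s : size (monic_pencil x) = n.+1 by rewrite size_scale ?invr_eq0 // size_pencil.
split=> //.
  move=> z; rewrite /monic_pencil map_polyZ /= rootZ ?fmorph_eq0 ?invr_eq0 //.
  exact: hpoly_real.
by rewrite monicE lead_coefE s /= coefZ coef_pencil_lead mulVf.
Qed.

Lemma spectrum_perm x rs : monic_pencil x = prod_XsubC rs -> spectrum x = sort >=%R rs.
Proof.
move=> E; rewrite /spectrum -(zerosE rs pe0) -E /monic_pencil.
by rewrite scalerA mulfV ?scale1r.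
Qed.

Lemma spectrumP x : [/\ monic_pencil x = prod_XsubC (spectrum x),
  size (spectrum x) = n & sorted >=%R (spectrum x)].
Proof.
have [rs ms ss] := monic_pencilP x; have [l El sl] := monic_factor rs ms ss.
rewrite (spectrum_perm El) size_sort; split=> //.
  by rewrite El; apply: perm_big; rewrite perm_sym perm_sort.
by apply: sort_sorted => a b; rewrite le_total.
Qed.

Lemma lambdaE x i : lambda S x i 0 = nth 0 (spectrum x) i.
Proof. by rewrite mxE. Qed.

Lemma sum_lambda x (f : R -> R) :
  \sum_(i < n) f (lambda S x i 0) = \sum_(r <- spectrum x) f r.
Proof.
have [_ s _] := spectrumP x.
rewrite (big_nth 0) s big_mkord; apply: eq_bigr => i _; by rewrite lambdaE.
Qed.

Lemma hconeE x : hcone S x <-> {in spectrum x, forall r, 0 <= r}.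
Proof.
have [_ s _] := spectrumP x; split=> [h r rs | h i]; last first.
  by rewrite lambdaE; apply: h; rewrite mem_nth // s.
rewrite -(nth_index 0 rs).
have il : (index r (spectrum x) < n)%N by rewrite -s index_mem.
by have := h (Ordinal il); rewrite lambdaE.
Qed.

Lemma traceE x : trace S x = - ('X^2 * monic_pencil x)`_n.+1.
Proof.
have [E s _] := spectrumP x.
rewrite /trace (sum_lambda x id) /= (sum_prod_XsubC (spectrum x)) s -E //.
Qed.

Lemma sqE x : sq x =
  ('X^2 * monic_pencil x)`_n.+1 ^+ 2 - 2 * ('X^2 * monic_pencil x)`_n.
Proof.
have [E s _] := spectrumP x.
rewrite /sq /sqnorm (sum_lambda x (fun r => r ^+ 2)) /=.
by rewrite (sum_sqr_prod_XsubC (spectrum x)) s -E.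
Qed.

Let gM x y := graded_scale pe^-1 (gP x y).
Let gX x y := graded_X2M (gM x y).

Lemma trace_line x y s : trace S (x + s *: y) = trace S x + s * trace S y.
Proof.
rewrite !traceE /monic_pencil (graded_linear s (gX x y)) scale0r addr0.
by ring.
Qed.

Lemma sq_line x y : exists b, forall s,
  sq (x + s *: y) = sq x + s * b + s ^+ 2 * sq y.
Proof.
have [b Hb] := graded_quadratic (gX x y).
pose t z := ('X^2 * monic_pencil z)`_n.+1.
(* The cross term of [(t x + s t y)^2], minus twice that of the second coefficient. *)
exists (2 * t x * t y - 2 * b) => s.
rewrite !sqE -!/(t _) {1}/monic_pencil Hb scale0r addr0 -!/(monic_pencil _).
have -> : t (x + s *: y) = t x + s * t y.
  by rewrite /t /monic_pencil (graded_linear s (gX x y)) scale0r addr0.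
by ring.
Qed.

Lemma innerE x y : inner S x y = polar sq x y.
Proof. by []. Qed.

Lemma traceD x y : trace S (x + y) = trace S x + trace S y.
Proof. by have := trace_line x y 1; rewrite scale1r mul1r. Qed.

Lemma trace0 : trace S 0 = 0.
Proof. by have := traceD 0 0; rewrite addr0; lra. Qed.

Lemma traceZ s x : trace S (s *: x) = s * trace S x.
Proof. by rewrite -[s *: x]add0r trace_line trace0 add0r. Qed.

(** Since [t e - (x + c e) = (t - c) e - x], adding [c e] translates the whole spectrum. *)
Lemma monic_pencil_shift x c :
  monic_pencil (x + c *: e) = prod_XsubC [seq r + c | r <- spectrum x].
Proof.
have [E s _] := spectrumP x.
have -> : monic_pencil (x + c *: e) = monic_pencil x \Po ('X - c%:P).
  apply: poly_ext => t _; rewrite /monic_pencil comp_polyZ !hornerZ horner_comp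
    !horner_pencil.
  by rewrite hornerXsubC scalerBl opprD addrA addrAC.
rewrite E big_map rmorph_prod /=; apply: eq_bigr => r _.
by rewrite comp_polyB comp_polyX comp_polyC (addrC r) polyCD opprD addrA.
Qed.

Lemma mem_spectrum_shift x c r : (r \in spectrum (x + c *: e)) = (r - c \in spectrum x).
Proof.
rewrite (spectrum_perm (monic_pencil_shift x c)) mem_sort.
by rewrite -{1}[r](subrK c) (mem_map (addIr c)).
Qed.

Lemma sum_spectrum_shift x c (f : R -> R) :
  \sum_(r <- spectrum (x + c *: e)) f r = \sum_(r <- spectrum x) f (r + c).
Proof.
rewrite (spectrum_perm (monic_pencil_shift x c)).
by rewrite (perm_big [seq r + c | r <- spectrum x]) ?perm_sort //= big_map.
Qed.

Lemma mem_spectrum x r : (r \in spectrum x) = root (pencilS x) r.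
Proof.
have [E _ _] := spectrumP x.
by rewrite -root_prod_XsubC -E rootZ // invr_eq0.
Qed.

Lemma mem_spectrum_scale x c r : c != 0 ->
  (c * r \in spectrum (c *: x)) = (r \in spectrum x).
Proof.
move=> c0; rewrite !mem_spectrum !rootE !horner_pencil -scalerA -scalerBr.
by rewrite (peval_scale _ _ (hpoly_homogeneous S)) mulf_eq0 expf_eq0 (negPf c0) andbF.
Qed.

End HyperbolicSystem.

(** * The hyperbolicity cone and positivity of the inner product *)

Section Cone.
Context {R : realType} {V : vectType R} {n : nat}.
Variable S : hyperbolic_system V n.
Implicit Types (x y : V).

Local Notation e := (hunit S).
Local Notation sq := (sq S).
Local Notation inn := (polar sq).

Let qL := sq_line S.

Lemma spectrum0 r : r \in spectrum S 0 -> r = 0.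
Proof.
rewrite mem_spectrum rootE horner_pencil subr0.
rewrite (peval_scale _ _ (hpoly_homogeneous S)) mulf_eq0 (negPf (hpoly_unit_neq0 S)).
by rewrite orbF expf_eq0 => /andP[_ /eqP].
Qed.

Lemma hcone0 : hcone S 0.
Proof. by apply/hconeE => r /spectrum0 ->. Qed.

Lemma hcone_scale c x : 0 <= c -> hcone S x -> hcone S (c *: x).
Proof.
rewrite le_eqVlt => /predU1P[<- _|c0 /hconeE Cx]; first by rewrite scale0r; exact: hcone0.
apply/hconeE => r; have -> : r = c * (c^-1 * r) by rewrite mulrA mulfV ?mul1r ?gt_eqF.
by rewrite mem_spectrum_scale ?gt_eqF // => /Cx r0; rewrite mulr_ge0 // ltW.
Qed.

Lemma spectrum_shift_gt0 c x : 0 < c -> hcone S x ->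
  {in spectrum S (x + c *: e), forall r, 0 < r}.
Proof.
move=> c0 /hconeE Cx r; rewrite mem_spectrum_shift => /Cx.
by rewrite subr_ge0; exact: lt_le_trans.
Qed.

Lemma hconeD_pos x y : hcone S x -> {in spectrum S y, forall r, 0 < r} ->
  hcone S (x + y) /\ sq x <= sq (x + y).
Proof.
move=> /hconeE Cx y0; have [Ey sy _] := spectrumP S y.
have [Ex _ _] := spectrumP S x; have [Exy _ _] := spectrumP S (x + y).
have gM := graded_scale (peval (hpoly S) e)^-1 (graded_pencil e x y (hpoly_homogeneous S)).
rewrite -/(monic_pencil S y) Ey in gM.
have [|||||h1 h2] := @graded_mono _ _ _ _ 0 1 (spectrum S x) (spectrum S (x + y)) sy y0 gM.
- by move=> s; exact: monic_pencilP.
- exact: ler01.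
- by rewrite scale0r addr0 -Ex.
- by rewrite scale1r -Exy.
- exact: Cx.
split; first exact/hconeE.
by rewrite /sq /sqnorm (sum_lambda S x (fun r => r ^+ 2)) (sum_lambda S (x + y) (fun r =>
  r ^+ 2)).
Qed.

Lemma hcone_shift_limit x : (forall c, 0 < c -> hcone S (x + c *: e)) -> hcone S x.
Proof.
move=> h; apply/hconeE => r rx; rewrite leNgt; apply/negP => r0.
(* The shift by [- r / 2] leaves the negative value [r / 2] in the spectrum. *)
have /hconeE Cx := h (- r / 2) (ltac:(by rewrite divr_gt0 ?oppr_gt0)).
have := Cx (r + - r / 2); rewrite mem_spectrum_shift addrK => /(_ rx); lra.
Qed.

Lemma hconeD x y : hcone S x -> hcone S y -> hcone S (x + y).
Proof.
move=> Cx Cy; apply: hcone_shift_limit => c c0; rewrite -addrA.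
by have [] := hconeD_pos Cx (spectrum_shift_gt0 c0 Cy).
Qed.

Lemma hcone_sum I (r : seq I) (P : pred I) (f : I -> V) :
  (forall i, P i -> hcone S (f i)) -> hcone S (\sum_(i <- r | P i) f i).
Proof.
by move=> h; elim/big_rec: _ => [|i x Pi Cx]; [exact: hcone0 | exact: hconeD (h _ Pi) Cx].
Qed.

Lemma linear_ge0_at0 a b : (forall s : R, 0 < s -> 0 <= a + s * b) -> 0 <= a.
Proof.
move=> h; have := @horner0_ge0 R (a%:P + b *: 'X); rewrite !hornerE; apply=> s s0.
by rewrite !hornerE mulrC h.
Qed.

(** For [z] with positive spectrum, [|x + s z|^2 >= |x|^2] gives [2 <x, z> + s |z|^2 >= 0], and
    [s -> 0]. Then [z = y + s e] with [s -> 0] once more. *)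
Lemma inner_ge0 x y : hcone S x -> hcone S y -> 0 <= inner S x y.
Proof.
move=> Cx Cy; rewrite innerE.
have pos z : {in spectrum S z, forall r, 0 < r} -> 0 <= inn x z.
  move=> z0; suff : 0 <= 2 * inn x z by lra.
  apply: (@linear_ge0_at0 _ (sq z)) => s s0.
  have sz0 : {in spectrum S (s *: z), forall r, 0 < r}.
    move=> r; have -> : r = s * (s^-1 * r) by rewrite mulrA mulfV ?mul1r ?gt_eqF.
    by rewrite mem_spectrum_scale ?gt_eqF // => /z0 r0; rewrite mulr_gt0.
  have [_ ] := hconeD_pos Cx sz0; rewrite (quad_line qL) => h.
  by rewrite -(pmulr_rge0 _ s0); lra.
apply: (@linear_ge0_at0 _ (inn x e)) => s s0.
rewrite -(polarZr qL) -(polarDr qL); apply: pos.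
exact: spectrum_shift_gt0.
Qed.

Lemma inner_unit x : inner S x e = trace S x.
Proof.
have [_ sz _] := spectrumP S x.
have sh c : sq (x + c *: e) = sq x + 2 * c * trace S x + n%:R * c ^+ 2.
  rewrite /sq /sqnorm (sum_lambda S x (fun r => r ^+ 2)) (sum_lambda S (x + c *: e) (fun r
    => r ^+ 2)).
  rewrite /trace (sum_lambda S x id) (sum_spectrum_shift S x c (fun r => r ^+ 2)).
  have -> : n%:R = (size (spectrum S x))%:R :> R by rewrite sz.
  elim: (spectrum S x) => [|r l IH].
    by rewrite !big_nil /=; ring.
  by rewrite !big_cons IH /= -natr1; ring.
by rewrite innerE /polar; have := sh 1; have := sh (- 1);
  rewrite scale1r scaleN1r => -> ->; field.
Qed.

Lemma trace_unit : trace S e = n%:R.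
Proof.
rewrite -[e]add0r -[X in 0 + X]scale1r /trace (sum_lambda S _ id) sum_spectrum_shift.
have [_ sz _] := spectrumP S 0.
rewrite (eq_big_seq (fun=> 1)) => [|r /spectrum0 -> /=]; last by rewrite add0r.
by rewrite big_const_seq count_predT sz iter_addr_0.
Qed.

Lemma sq_le_trace x : hcone S x -> sq x <= trace S x ^+ 2.
Proof.
move=> /hconeE Cx.
rewrite /sq /sqnorm /trace (sum_lambda S x (fun r => r ^+ 2)) (sum_lambda S x id) /=.
(* The induction also needs the sum to be nonnegative, to discard the cross term. *)
suff [//] : \sum_(r <- spectrum S x) r ^+ 2 <= (\sum_(r <- spectrum S x) r) ^+ 2 /\
   0 <= \sum_(r <- spectrum S x) r.
elim: (spectrum S x) Cx => [_|r l IH Cx]; first by rewrite !big_nil expr0n lexx.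
have r0 : 0 <= r by apply: Cx; rewrite mem_head.
have [|h1 h2] := IH; first by move=> u ul; apply: Cx; rewrite inE ul orbT.
by rewrite !big_cons; split; [nra | exact: addr_ge0].
Qed.

Lemma sq_ge0 x : 0 <= sq x.
Proof. by apply: sumr_ge0 => i _; exact: sqr_ge0. Qed.

Lemma spectrum_sqr_le x r : r \in spectrum S x -> r ^+ 2 <= sq x.
Proof.
move=> rx; rewrite /sq /sqnorm (sum_lambda S x (fun r => r ^+ 2)) /=.
rewrite (perm_big _ (perm_to_rem rx)) big_cons lerDl.
by apply: sumr_ge0 => i _; exact: sqr_ge0.
Qed.

(** Every spectral value of [x] is at least [- c]: in terms of the norm, [e] is interior to the
    cone. *)
Lemma hcone_shift_norm x c : 0 <= c -> sq x <= c ^+ 2 -> hcone S (x + c *: e).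
Proof.
move=> c0 xc; apply/hconeE => r; rewrite mem_spectrum_shift => /spectrum_sqr_le h.
have {}h := le_trans h xc.
have : `|r - c| <= c by rewrite -(ler_pXn2r (n := 2)) ?nnegrE // real_normK ?num_real.
by rewrite ler_norml => /andP[]; lra.
Qed.

Definition primitive_lambda : 'cV[R]_n := \col_(j < n) (j == 0 :> nat)%:R.

(** The values lie in [[0, 1]] and have equal sum and sum of squares, so each [a (1 - a)] is 0.
    Decreasing order and total 1 leave a single 1, in front. *)
Lemma lambda_primitive x : hcone S x -> trace S x = 1 -> sq x = 1 ->
  lambda S x = primitive_lambda.
Proof.
move=> Cx tx qx; have [_ sz so] := spectrumP S x.
pose a i := lambda S x i 0.
have a0 i : 0 <= a i by exact: Cx.
have sa : \sum_(i < n) a i = 1 by [].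
have a1 i : a i <= 1.
  by rewrite -sa (bigD1 i) //= lerDl; apply: sumr_ge0.
have a01 i : a i = 0 \/ a i = 1.
  have : a i - a i ^+ 2 = 0.
    apply: (psumr_eq0P (P := predT) (F := fun i => a i - a i ^+ 2)) => //.
      by move=> j _; have := a0 j; have := a1 j; nra.
    by rewrite sumrB sa -[X in X - _]qx subrr.
  have -> : a i - a i ^+ 2 = a i * (1 - a i) by ring.
  by move/eqP; rewrite mulf_eq0 subr_eq0 => /orP[/eqP|/eqP]; [left | right].
have amax (i j : 'I_n) : j = 0 :> nat -> a i <= a j.
  move=> j0; rewrite /a !lambdaE j0.
  apply: (sorted_leq_nth (rev_trans le_trans) lexx 0 so) => //; rewrite inE sz //.
  by rewrite -j0.
apply/matrixP => i j; rewrite [RHS]mxE ord1 -/(a i).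
have [k k0] : exists k : 'I_n, k = 0 :> nat.
  by have n0 : (0 < n)%N := leq_ltn_trans (leq0n i) (ltn_ord i); exists (Ordinal n0).
have ak : a k = 1.
  have [ak|//] := a01 k; move: sa; rewrite big1 => [/esym/eqP|l _];
    first by rewrite oner_eq0.
  by apply/le_anti; rewrite a0 -ak amax.
case: eqP => [i0|i0].
  by rewrite -ak; congr a; apply: val_inj; rewrite /= i0 k0.
have ki : k != i by apply/eqP => ki; apply: i0; rewrite -ki.
have rest : \sum_(l < n | l != k) a l = 0.
  by apply: (addrI 1); rewrite addr0 -[RHS]sa [RHS](bigD1 k) //= ak.
by apply: (psumr_eq0P (P := fun i => i != k) (F := a)) => //; rewrite eq_sym.
Qed.

Lemma primitive_lambdaP x : (0 < n)%N -> lambda S x = primitive_lambda ->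
  [/\ hcone S x, trace S x = 1 & sq x = 1].
Proof.
move=> n0 E; have Ei i : lambda S x i 0 = (i == 0 :> nat)%:R by rewrite E mxE.
have s1 : \sum_(i < n) (i == 0 :> nat)%:R = 1 :> R.
  rewrite (bigD1 (Ordinal n0)) //= big1 ?addr0 // => i; rewrite -val_eqE /=.
  by move/negPf => ->.
split.
- by move=> i; rewrite Ei ler0n.
- by rewrite /trace; under eq_bigr do rewrite Ei.
- rewrite /sq /sqnorm; under eq_bigr do rewrite Ei -natrX.
  by rewrite -[RHS]s1; apply: eq_bigr => i _; case: eqP.
Qed.

End Cone.

(** * Doubly stochastic matrices *)

Section DoublyStochastic.
Context {R : realType} {V : vectType R} {n : nat}.
Variable S : hyperbolic_system V n.
Hypothesis complS : complete_system S.
Implicit Types (x y : V) (A B C : vmatrix V n).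

Local Notation e := (hunit S).
Local Notation sq := (sq S).
Local Notation inn := (polar sq).

Let qL := sq_line S.

Lemma sq_eq0 x : sq x <= 0 -> x = 0.
Proof.
move=> q0; apply: complS; apply/matrixP => i j; rewrite ord1 [RHS]mxE.
have /eqP : sq x = 0 by apply/le_anti; rewrite q0 sq_ge0.
rewrite psumr_eq0 => [/allP/(_ i (mem_index_enum i))|k _]; last exact: sqr_ge0.
by rewrite /= sqrf_eq0 => /eqP.
Qed.

(** For [n = 0] every [lambda] is the empty column, and completeness would give [e = 0]. *)
Lemma complete_degree_gt0 : (0 < n)%N.
Proof.
rewrite lt0n; apply/negP => /eqP n0; have /eqP := hunit_neq0 S; apply.
by apply: complS; apply/matrixP => i; have := ltn_ord i; rewrite [X in (_ < X)%N]n0.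
Qed.

Lemma sq_combination (t : R) y z :
  sq (t *: y + (1 - t) *: z) = t * sq y + (1 - t) * sq z - t * (1 - t) * sq (y - z).
Proof.
have -> : t *: y + (1 - t) *: z = z + t *: (y - z).
  by rewrite scalerBl scale1r scalerBr addrCA.
have E : sq y = sq z + 2 * inn z (y - z) + sq (y - z).
  by rewrite -(quadD qL) addrC subrK.
by rewrite (quad_line qL) E; ring.
Qed.

(** By [sq_combination], a proper combination of two distinct points of the unit ball has norm
    strictly below 1. *)
Lemma unit_sphere_extreme (K : set V) x : K x -> sq x = 1 ->
  (forall y, K y -> sq y <= 1) -> Ext K x.
Proof.
move=> Kx qx K1; split=> // y z t Ky Kz t0 t1 E.
have yz : y - z = 0.
  apply: sq_eq0; have := sq_combination t y z; rewrite -E qx.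
  have := K1 _ Ky; have := K1 _ Kz => hz hy h.
  have tt : 0 < t * (1 - t) by rewrite mulr_gt0 ?subr_gt0.
  by rewrite -(pmulr_rle0 _ tt); nra.
move/eqP: yz; rewrite subr_eq0 => /eqP yz; move: E.
by rewrite yz -scalerDl addrC subrK scale1r => ->.
Qed.

Lemma Delta_sq x : Delta S x -> sq x <= 1.
Proof.
by move=> [Cx tx]; move: Cx; rewrite /hle subr0 => /sq_le_trace; rewrite tx expr1n.
Qed.

Lemma DS_Delta A i : DS S A -> Delta S (A i).
Proof. by move=> [CA tA _]; split=> //; rewrite /hle subr0. Qed.

Lemma DS_split (A : vmatrix V n) (s : 'S_n) (k : 'I_n) : \sum_i A i =
  \sum_(j < n | (j < k)%N) A (s j) + A (s k) + \sum_(j < n | (k < j)%N) A (s j).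
Proof.
rewrite (reindex_inj (@perm_inj _ s)) (bigID (fun j : 'I_n => (j < k)%N)) /= -addrA.
congr (_ + _); rewrite (bigD1 k) /= ?ltnn //; congr (_ + _); apply: eq_bigl => j.
by rewrite -leqNgt ltn_neqAle andbC eq_sym.
Qed.

Lemma DS_Delta_below A (s : 'S_n) (k : 'I_n) : DS S A ->
  Delta_below S (\sum_(j < n | (j < k)%N) A (s j)) (A (s k)).
Proof.
move=> dA; have [dk1 dk2] := DS_Delta (s k) dA; have [CA _ sA] := dA.
split=> //; rewrite /hle -sA (DS_split A s k).
(* What remains below [e] is the sum of the later columns, which lies in the cone. *)
have -> (b a r : V) : b + a + r - b - a = r.
  by rewrite (addrC _ r) -!addrA (addrCA a) subrr addr0 subrr addr0.
by apply: hcone_sum => j _; exact: CA.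
Qed.

Lemma JF_DS A : JF S A -> DS S A.
Proof.
move=> [lA sA]; have n0 := complete_degree_gt0.
by split=> // i; have [] := primitive_lambdaP n0 (lA i).
Qed.

Lemma JF_sq A i : JF S A -> sq (A i) = 1.
Proof.
by move=> [lA _]; have [] := primitive_lambdaP complete_degree_gt0 (lA i).
Qed.

(** Row [i] sums to [<a_i, e> = tr a_i = 1], which the diagonal entry already uses up; the other
    entries are nonnegative, hence 0. *)
Lemma JF_star A : JF S A -> star S A A = 1%:M.
Proof.
move=> jA; have [CA tA sA] := JF_DS jA.
apply/matrixP => i j; rewrite !mxE.
have Iii : inner S (A i) (A i) = 1 by rewrite innerE (polarxx qL) JF_sq.
have [<-|ij] := eqVneq i j; first by [].
apply: (psumr_eq0P (P := fun j => j != i) (F := fun j => inner S (A i) (A j))).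
- by move=> k _; exact: inner_ge0.
- have s1 : \sum_j inner S (A i) (A j) = 1.
    by rewrite -(polar_sumr qL) -innerE sA inner_unit tA.
  by apply: (addrI 1); rewrite addr0 -[RHS]s1 [RHS](bigD1 i) //= Iii.
- by rewrite eq_sym.
Qed.

Lemma JF_eq : JF S = [set A | DS S A /\ exists B, DS S B /\ star S A B = 1%:M].
Proof.
apply/seteqP; split=> [A jA | A [dA [B [dB AB]]]].
  by split; [exact: JF_DS | exists A; split; [exact: JF_DS | exact: JF_star]].
have [CA tA sA] := dA; split=> // i.
apply: lambda_primitive => //.
have qA := Delta_sq (DS_Delta i dA); have qB := Delta_sq (DS_Delta i dB).
have : inn (A i) (B i) = 1.
  by move/matrixP/(_ i i): AB; rewrite !mxE eqxx innerE.
(* With both norms at most 1 and inner product 1, [|a_i - b_i|^2 >= 0] forces [|a_i| = 1]. *)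
have := sq_ge0 S (A i - B i); rewrite (quadB qL) => h h1.
by apply/le_anti; rewrite qA /=; rewrite h1 in h; lra.
Qed.

Lemma JF_GJF : JF S `<=` GJF S.
Proof.
move=> A jA; have dA := JF_DS jA; exists 1%g; split=> k _.
- apply: unit_sphere_extreme; [exact: DS_Delta | exact: JF_sq | exact: Delta_sq].
- apply: unit_sphere_extreme; [exact: DS_Delta_below | exact: JF_sq |].
  by move=> y [/Delta_sq].
Qed.

(** Only the sum of the columns is in question. The defect [w] has trace [n - n = 0], and the
    condition on the last column puts it in the cone, so [|w| <= tr w = 0]. *)
Lemma GJF_DS : GJF S `<=` DS S.
Proof.
move=> A [s [s0 sk]]; have n0 := complete_degree_gt0.
have dA i : Delta S (A i).
  rewrite -(permKV s i); set k := (s^-1)%g i.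
  have [k0|] := posnP k; first by have [] := s0 k k0.
  by move=> /sk[[]].
have CA i : hcone S (A i) by have [+ _] := dA i; rewrite /hle subr0.
have tA i : trace S (A i) = 1 by have [_ ] := dA i.
split=> //.
pose w := e - \sum_i A i.
have tw : trace S w = 0.
  rewrite /w -scaleN1r traceD traceZ trace_unit.
  have -> : trace S (\sum_i A i) = n%:R; last by rewrite mulN1r subrr.
  rewrite -inner_unit innerE (polar_suml qL).
  under eq_bigr do rewrite -innerE inner_unit tA.
  by rewrite sumr_const card_ord.
suff w0 : w = 0 by move/eqP: w0; rewrite subr_eq0 => /eqP.
apply: sq_eq0.
(* For [n = 1] no column has a predecessor; the single entry of [lambda w] is then its trace. *)
have [n1|n1] := leqP n 1.
  have En : n = 1%N by apply/eqP; rewrite eqn_leq n1.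
  move: tw; rewrite /sq /sqnorm /trace; clear -En.
  move: (lambda S w); rewrite En => l; rewrite !big_ord_recl !big_ord0 !addr0 => ->.
  by rewrite expr0n.
have [m Em] : exists m : 'I_n, m = n.-1 :> nat.
  have lt : (n.-1 < n)%N by rewrite prednK.
  by exists (Ordinal lt).
have m0 : (0 < m)%N by rewrite Em -subn1 subn_gt0.
have [[_ _ Cw] _] := sk m m0.
have Ew : w = e - \sum_(j < n | (j < m)%N) A (s j) - A (s m).
  have rest0 : \sum_(j < n | (m < j)%N) A (s j) = 0.
    by apply: big1 => j; rewrite Em ltnNge -ltnS prednK // ltn_ord.
  by rewrite /w (DS_split A s m) rest0 addr0 opprD addrA.
by have := sq_le_trace Cw; rewrite -Ew tw expr0n.
Qed.

(** Induction along [s]: once the earlier columns of [B] and [C] agree with those of [A], the next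
    columns lie in the same [Delta_below], where that of [A] is extreme. *)
Lemma GJF_Ext : GJF S `<=` Ext (DS S).
Proof.
move=> A gA; have dA := GJF_DS gA; split=> // B C t dB dC t0 t1 E.
have [s [s0 sk]] := gA.
have Ek k : A k = t *: B k + (1 - t) *: C k by rewrite E !ffunE.
have main m : forall k : 'I_n, k = m :> nat -> B (s k) = A (s k) /\ C (s k) = A (s k).
  elim/ltn_ind: m => m IH k km.
  have [k0|k0] := posnP k.
    have [_ ext] := s0 k k0; apply: (ext _ _ t) => //; exact: DS_Delta.
  have [_ ext] := sk k k0.
  have sB : \sum_(j < n | (j < k)%N) A (s j) = \sum_(j < n | (j < k)%N) B (s j).
    by apply: eq_bigr => j; rewrite km => jm; have [BA CA] := IH j jm j erefl.
  have sC : \sum_(j < n | (j < k)%N) A (s j) = \sum_(j < n | (j < k)%N) C (s j).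
    by apply: eq_bigr => j; rewrite km => jm; have [BA CA] := IH j jm j erefl.
  apply: (ext _ _ t) => //; [rewrite sB | rewrite sC]; exact: DS_Delta_below.
split; apply/ffunP => i; rewrite -(permKV s i);
  by have [] := main _ _ (erefl (nat_of_ord ((s^-1)%g i))).
Qed.

Lemma DS_nonempty : DS S !=set0.
Proof.
have n0 : (n%:R : R) != 0 by rewrite pnatr_eq0 -lt0n complete_degree_gt0.
have Ce : hcone S e.
  by rewrite -[e]add0r -[X in 0 + X]scale1r; apply: hcone_shift_norm;
    rewrite ?ler01 // (quad0 qL) expr1n ler01.
exists [ffun=> n%:R^-1 *: e]; split=> [i|i|]; rewrite ?ffunE.
- by apply: hcone_scale Ce; rewrite invr_ge0 ler0n.
- by rewrite traceZ trace_unit mulVf.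
- under eq_bigr do rewrite ffunE.
  by rewrite sumr_const card_ord -scaler_nat scalerA mulfV ?scale1r.
Qed.

Lemma DS_convex : convex_set (DS S).
Proof.
move=> A B t; rewrite !inE => -[CA tA sA] [CB tB sB].
have t0 : 0 <= t%:num by [].
have t1 : 0 <= 1 - t%:num by rewrite subr_ge0.
have Ei i : (conv t A B : vmatrix V n) i = t%:num *: A i + (1 - t%:num) *: B i.
  by rewrite !ffunE.
split=> [i|i|].
- by rewrite Ei; apply: hconeD; exact: hcone_scale.
- by rewrite Ei traceD !traceZ tA tB !mulr1 addrC subrK.
- under eq_bigr do rewrite Ei.
  by rewrite big_split /= -!scaler_sumr sA sB -scalerDl addrC subrK scale1r.
Qed.

End DoublyStochastic.

(** * Compactness in the norm topology *)

Section Compactness.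
Context {R : realType} {V : vectType R} {n : nat}.
Variable S : hyperbolic_system V n.
Hypothesis complS : complete_system S.
Implicit Types (x y : V) (A B C : vmatrix V n).

Local Notation e := (hunit S).
Local Notation sq := (sq S).
Local Notation inn := (polar sq).
Local Notation d := (\dim (fullv : {vspace V})).
Local Notation b := (vbasis (fullv : {vspace V})).

Let qL := sq_line S.

(** A form of the Cauchy-Schwarz bound without square roots, from [|x + y|^2 >= 0] and
    [|x - y|^2 >= 0]. *)
Lemma polar_le x y : `|2 * inn x y| <= sq x + sq y.
Proof.
have := sq_ge0 S (x - y); have := sq_ge0 S (x + y).
rewrite (quadB qL) (quadD qL) ler_norml => h1 h2; apply/andP; split; lra.
Qed.

Lemma sq_sum_le (I : finType) (f : I -> V) :
  sq (\sum_i f i) <= #|I|%:R * \sum_i sq (f i).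
Proof.
have [I0|I0] := posnP #|I|.
  rewrite big1 => [|i _]; last by have := fintype0 i I0.
  by rewrite (quad0 qL) I0 mul0r.
have c0 : 0 < #|I|%:R :> R by rewrite ltr0n.
set s := \sum_i f i; set c := #|I|%:R in c0 *.
(* The variance about the mean [c^-1 *: s] is nonnegative. *)
have : 0 <= \sum_i sq (f i - c^-1 *: s) by apply: sumr_ge0 => i _; exact: sq_ge0.
under eq_bigr do rewrite (quadB qL).
have cst (a : R) : \sum_(i : I) a = c * a by rewrite sumr_const mulr_natl.
rewrite big_split /= sumrB -mulr_sumr -(polar_suml qL) -/s cst.
rewrite (polarZr qL) (polarxx qL).
have -> : sq (c^-1 *: s) = c^-1 ^+ 2 * sq s.
  by rewrite -(polarxx qL) (polarZr qL) (polarZl qL) (polarxx qL) mulrA.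
set T := \sum_i _ => h.
have : 0 <= c * (T - 2 * (c^-1 * sq s) + c * (c^-1 ^+ 2 * sq s)) by rewrite mulr_ge0 // ltW.
have -> : c * (T - 2 * (c^-1 * sq s) + c * (c^-1 ^+ 2 * sq s)) = c * T - sq s.
  by field; rewrite gt_eqF.
by rewrite subr_ge0.
Qed.

Lemma vnorm_lt A (r : R) : 0 < r -> (vnorm S A < r) = (\sum_i sq (A i) < r ^+ 2).
Proof.
move=> r0; rewrite /vnorm -{1}[r](gtr0_norm r0) -sqrtr_sqr ltr_sqrt ?exprn_gt0 //.
by congr (_ < _); apply: eq_bigr => i _; rewrite innerE (polarxx qL).
Qed.

Lemma sq_le_sum A i : sq (A i) <= \sum_i sq (A i).
Proof. by rewrite (bigD1 i) //= lerDl; apply: sumr_ge0 => j _; exact: sq_ge0. Qed.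

Lemma sqN x : sq (- x) = sq x.
Proof. exact: quadN qL x. Qed.

Lemma trace_sqr_le x : trace S x ^+ 2 <= n%:R * sq x.
Proof.
have n0 : 0 < n%:R :> R by rewrite ltr0n; exact: complete_degree_gt0 complS.
have qe : sq e = n%:R by rewrite -(polarxx qL) -innerE inner_unit trace_unit.
have tx : inn x e = trace S x by rewrite -innerE inner_unit.
have := sq_ge0 S (x - (trace S x / n%:R) *: e).
rewrite (quadB qL) (polarZr qL) tx.
have -> : sq ((trace S x / n%:R) *: e) = (trace S x / n%:R) ^+ 2 * n%:R.
  by rewrite -(polarxx qL) (polarZr qL) (polarZl qL) (polarxx qL) qe mulrA.
move=> h; have : 0 <= n%:R * (sq x - 2 * (trace S x / n%:R * trace S x) + (trace S x /
  n%:R) ^+ 2 * n%:R).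
  by rewrite mulr_ge0 // ltW.
have -> : n%:R * (sq x - 2 * (trace S x / n%:R * trace S x) + (trace S x / n%:R) ^+ 2 *
  n%:R)
   = n%:R * sq x - trace S x ^+ 2 by field; rewrite gt_eqF.
by rewrite subr_ge0.
Qed.

(** A matrix outside [DS S] violates one of three conditions, and each violation persists within an
    explicit radius. *)
Lemma DS_closed : closed (DS S : set (vhilbert S)).
Proof.
rewrite -[X in closed X]setCK; apply: open_closedC.
suff : vopen S (~` DS S) by [].
have n0 : 0 < n%:R :> R by rewrite ltr0n; exact: complete_degree_gt0 complS.
move=> A nA.
have [CA|/existsNP[i nCi]] := pselect (forall i, hcone S (A i)); last first.
  have [c c0 nC] : exists2 c, 0 < c & ~ hcone S (A i + c *: e).
    apply: contrapT => H; apply: nCi; apply: hcone_shift_limit => c c0.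
    by apply: contrapT => H'; apply: H; exists c.
  (* If [B i] were in the cone at distance less than [c], adding [A i - B i + c e] would put
     [A i + c e] there too. *)
  exists c => // B; rewrite vnorm_lt // => BA [CB _ _]; apply: nC.
  have -> : A i + c *: e = B i + (A i - B i + c *: e) by rewrite addrA addrC subrKC addrC.
  apply: hconeD; first exact: CB.
  apply: hcone_shift_norm; first exact: ltW.
  rewrite -sqN opprB; apply: le_trans (ltW BA).
  by have := sq_le_sum (B - A) i; rewrite !ffunE.
have [tA|/existsNP[i nti]] := pselect (forall i, trace S (A i) = 1); last first.
  set t := trace S (A i) in nti.
  have t0 : 0 < `|t - 1| by rewrite normr_gt0 subr_eq0; apply/eqP.
  (* The trace is Lipschitz with constant [sqrt n], by [trace_sqr_le]; dividing by [n >= sqrt n]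
     avoids a root. *)
  exists (`|t - 1| / n%:R); first by rewrite divr_gt0.
  move=> B; rewrite vnorm_lt ?divr_gt0 // => BA [_ tB _].
  have := trace_sqr_le (B i - A i).
  rewrite -scaleN1r traceD traceZ tB -/t mulN1r leNgt => /negP; apply.
  have n1 : 1 <= n%:R :> R by rewrite ler1n; exact: complete_degree_gt0 complS.
  rewrite scaleN1r.
  have {BA} : sq (B i - A i) < (`|t - 1| / n%:R) ^+ 2.
    apply: le_lt_trans BA.
    by have := sq_le_sum (B - A) i; rewrite !ffunE.
  rewrite expr_div_n real_normK ?num_real // ltr_pdivlMr ?exprn_gt0 // => h.
  have -> : (1 - t) ^+ 2 = (t - 1) ^+ 2 by ring.
  apply: le_lt_trans h; rewrite mulrC ler_wpM2l ?sq_ge0 //.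
  by rewrite expr2 ler_peMr // ltW.
pose w := \sum_i A i - e.
have w0 : 0 < sq w.
  rewrite ltNge; apply/negP => /(sq_eq0 complS)/eqP; rewrite subr_eq0 => /eqP sA.
  exact: nA.
exists (Num.sqrt (sq w / n%:R)); first by rewrite sqrtr_gt0 divr_gt0.
move=> B; rewrite vnorm_lt ?sqrtr_gt0 ?divr_gt0 // sqr_sqrtr ?divr_ge0 ?ltW //.
rewrite ltr_pdivlMr // mulrC => BA [_ _ sB].
have := sq_sum_le (B - A); rewrite card_ord.
have -> : \sum_i (B - A : vmatrix V n) i = - w.
  by rewrite /w opprB -sB -sumrB; apply: eq_bigr => i _; rewrite !ffunE.
by rewrite sqN leNgt BA.
Qed.

Definition gram : 'M[R]_d := \matrix_(i, j) inn b`_i b`_j.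

Lemma coord_row_gram x k :
  (\row_i coord b i x *m gram) 0 k = inn x b`_k.
Proof.
rewrite mxE [in RHS](coord_vbasis (memvf x)) (polar_suml qL).
by apply: eq_bigr => i _; rewrite !mxE (polarZl qL).
Qed.

(** A kernel vector gives an [x] orthogonal to the basis, hence to itself, and the form is definite
    by completeness. *)
Lemma gram_unit : gram \in unitmx.
Proof.
rewrite -row_free_unit; apply: inj_row_free => u uG.
pose x := \sum_i u 0 i *: b`_i.
have cx i : coord b i x = u 0 i by rewrite coord_sum_free // (basis_free (vbasisP _)).
have ux : \row_i coord b i x = u by apply/rowP => i; rewrite mxE cx.
have x0 : x = 0.
  apply: (sq_eq0 complS); rewrite -(polarxx qL) {2}/x (polar_sumr qL) big1 // => k _.
  by rewrite (polarZr qL) -coord_row_gram ux uG mxE mulr0.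
by rewrite -ux x0; apply/rowP => i; rewrite !mxE linear0.
Qed.

(** The inverse Gram matrix recovers the coordinates from the products with the basis, which
    [polar_le] bounds; the sum over all [i] serves every coordinate at once. *)
Lemma coord_bounded : exists M, forall x i, sq x <= 1 -> `|coord b i x| <= M.
Proof.
exists (\sum_(i < d) \sum_(k < d) (1 + sq b`_k) * `|invmx gram k i|) => x i x1.
have -> : coord b i x = \sum_(k < d) inn x b`_k * invmx gram k i.
  have := mulmxK gram_unit (\row_i coord b i x) => /rowP/(_ i); rewrite [RHS]mxE => <-.
  by rewrite mxE; apply: eq_bigr => k _; rewrite coord_row_gram.
rewrite [leRHS](bigD1 i) //= ler_wpDr //.
  apply: sumr_ge0 => j _; apply: sumr_ge0 => k _; rewrite mulr_ge0 // addr_ge0 //.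
  exact: sq_ge0.
apply: le_trans (ler_norm_sum _ _ _) _; apply: ler_sum => k _; rewrite normrM.
apply: ler_wpM2r => //; have := polar_le x b`_k; rewrite normrM (ger0_norm (ler0n _ 2)).
have := normr_ge0 (inn x b`_k); have := sq_ge0 S b`_k; lra.
Qed.

Lemma sq_basis_combination : exists2 L, 0 < L & forall (u : 'I_d -> R) (m : R),
  (forall j, `|u j| <= m) -> sq (\sum_j u j *: b`_j) <= m ^+ 2 * L.
Proof.
exists (1 + \sum_(j < d) \sum_(k < d) `|inn b`_j b`_k|).
  by rewrite ltr_wpDr // sumr_ge0 // => j _; apply: sumr_ge0.
move=> u m um; rewrite -(polarxx qL) (polar_suml qL).
apply: (@le_trans _ _ (m ^+ 2 * \sum_(j < d) \sum_(k < d) `|inn b`_j b`_k|)); last first.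
  by rewrite ler_wpM2l ?sqr_ge0 // lerDr.
rewrite mulr_sumr; apply: ler_sum => j _.
rewrite (polar_sumr qL) mulr_sumr; apply: ler_sum => k _.
rewrite (polarZr qL) (polarZl qL) mulrA (le_trans (ler_norm _)) // !normrM.
rewrite ler_wpM2r // expr2 ler_pM //.
Qed.

(** Transports Heine-Borel from row vectors with the sup norm to the topology of [vnorm S]. *)
Definition of_coords (v : 'rV[R]_(n * d)) : vhilbert S :=
  [ffun i => \sum_j v 0 (mxvec_index i j) *: b`_j].

Lemma of_coords_surj (A : vhilbert S) :
  of_coords (mxvec (\matrix_(i, j) coord b j (A i))) = A.
Proof.
apply/ffunP => i; rewrite ffunE [RHS](coord_vbasis (memvf _)).
by apply: eq_bigr => j _; rewrite mxvecE mxE.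
Qed.

Lemma of_coords_continuous : continuous of_coords.
Proof.
apply/continuousP => U; change (vopen S U -> open (of_coords @^-1` U)) => oU.
rewrite openE => v Uv; have [r r0 rU] := oU _ Uv.
have [L L0 HL] := sq_basis_combination.
have n0 : 0 < n%:R :> R by rewrite ltr0n; exact: complete_degree_gt0 complS.
(* Chosen so that [n L < c < c^2]: the radius [r / c] then gives a squared norm below [r^2]. *)
pose c := n%:R * L + 1.
have c1 : 1 < c by rewrite /c ltrDr mulr_gt0.
have c0 : 0 < c by apply: lt_trans c1.
apply/nbhs_ballP; exists (r / c) => /=; first by rewrite divr_gt0.
move=> w [_ vw]; apply: rU; rewrite vnorm_lt //.
have le i : sq ((of_coords w - of_coords v : vmatrix V n) i) <= (r / c) ^+ 2 * L.
  rewrite !ffunE -sumrB; under eq_bigr do rewrite -scalerBl.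
  apply: HL => j; rewrite distrC ltW //; exact: vw.
apply: (@le_lt_trans _ _ (\sum_(i < n) (r / c) ^+ 2 * L)).
  by apply: ler_sum => i _; exact: le.
rewrite sumr_const card_ord -mulr_natl expr_div_n.
have -> : n%:R * (r ^+ 2 / c ^+ 2 * L) = r ^+ 2 * (n%:R * L / c ^+ 2) by field;
  rewrite gt_eqF.
rewrite gtr_pMr ?exprn_gt0 // ltr_pdivrMr ?exprn_gt0 // mul1r.
apply: (@lt_trans _ _ c); first by rewrite /c ltrDl.
by rewrite expr2 ltr_pMr.
Qed.

(** Columns have norm at most 1, so the coordinates of [DS S] form a closed subset of a box, and
    [DS S] is its continuous image. *)
Lemma DS_compact : compact (DS S : set (vhilbert S)).
Proof.
have DSE : DS S = of_coords @` (of_coords @^-1` DS S).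
  apply/seteqP; split=> [A dA | _ [v dv <-] //].
  by exists (mxvec (\matrix_(i, j) coord b j (A i))); rewrite /= of_coords_surj.
rewrite DSE; apply: continuous_compact.
  by apply: continuous_subspaceT; exact: of_coords_continuous.
have cl : closed (of_coords @^-1` DS S).
  by apply: closed_comp => [v _|]; [exact: of_coords_continuous | exact: DS_closed].
have [M HM] := coord_bounded.
apply: (subclosed_compact cl (@rV_compact _ _ (fun=> `[- M, M]%classic) (fun=>
  @segment_compact _ _ _))).
move=> v dv k; case/mxvec_indexP: k => i j /=.
rewrite in_itv /= -ler_norml.
have -> : v 0 (mxvec_index i j) = coord b j (of_coords v i).
  by rewrite ffunE coord_sum_free // (basis_free (vbasisP _)).
by apply: HM; exact: Delta_sq (DS_Delta i dv).
Qed.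

End Compactness.

Theorem theorem6p1 (R : realType) (V : vectType R) (n : nat)
    (S : hyperbolic_system V n) (complS : complete_system S) :
  [/\ [/\ DS S !=set0,
          compact (DS S : set (vhilbert S))
        & convex_set (DS S)],
      JF S = [set A | DS S A /\ exists B, DS S B /\ star S A B = 1%:M]
    & JF S `<=` GJF S /\ GJF S `<=` Ext (DS S)].
Proof.
split; last by split; [exact: JF_GJF | exact: GJF_Ext].
- split; [exact: DS_nonempty | exact: DS_compact | exact: DS_convex].
- exact: JF_eq.
Qed.
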